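(* Let $n \in \mathbb{N}$, $n \geq 4$, be arbitrary and let $\mathcal{PORI}_{n}$ be the inverse monoid of orientation-preserving or orientation-reversing partial permutations of $\{1,\ldots,n\}$ with the usual order. For $k \in \mathbb{N}$, let $\mathbb{P}_{k}$ denote the set of all primes that divide $k$. Then the maximal subsemigroups of $\mathcal{PORI}_{n}$ are precisely: (a) $(\mathcal{PORI}_{n} \setminus \mathcal{D}_{n}) \cup U$, where $U$ is a maximal subgroup of $\mathcal{D}_{n}$ (type (M5)), and (b) $\langle\mathcal{PORI}_{n} \setminus J_{n - 1},\ \zeta_{n}^{p},\ \tau_{n}\rangle$, where $p \in \mathbb{P}_{n - 1}$, and the partial permutations $\zeta_{n}$ and $\tau_{n}$ are defined by $$\zeta_{n} = \begin{pmatrix} 1 & 2 & \cdots & n - 2 & n - 1 & n\\ 2 & 3 & \cdots & n - 1 & 1 & - \end{pmatrix} \quad\text{and}\quad \tau_{n} = \begin{pmatrix} 1 & 2 & \cdots & n - 1 & n\\ n - 1 & n - 2 & \cdots & 1 & - \end{pmatrix}$$ (type (M5)). For $n \in \{1, 2, 3\}$, $\mathcal{PORI}_{n} = \mathcal{I}_{n}$, the symmetric inverse monoid of degree $n$. In particular, there are $1 + |\mathbb{P}_{n - 1}| + \sum_{p \in \mathbb{P}_{n}} p$ maximal subsemigroups of $\mathcal{PORI}_{n}$ for $n \geq 3$.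
   Context: $\mathbb{N}=\{1,2,3,\ldots\}$. A maximal subsemigroup of a semigroup $S$ (maximal subgroup of a group) is a proper subsemigroup (subgroup) not contained in any other proper one. $\langle\cdot\rangle$ denotes the subsemigroup generated by the listed sets and elements. $\mathcal{PT}_n$ is the monoid of all partial maps from $\{1,\ldots,n\}$ to itself under composition (maps written on the right); $\mathcal{I}_n$ is the submonoid of injective elements (partial permutations). If $\operatorname{dom}(\alpha)=\{i_1<\cdots<i_k\}$, put $i_{k+1}=i_1$; $\alpha$ is orientation-preserving if there is at most one $l\in\{1,\ldots,k\}$ with $i_l\alpha>i_{l+1}\alpha$, and orientation-reversing if there is at most one $l\in\{1,\ldots,k\}$ with $i_l\alpha<i_{l+1}\alpha$. $J_{n-1}=\{\alpha\in\mathcal{PT}_n:|\operatorname{im}(\alpha)|=n-1\}$. $\mathcal{D}_n=\langle (1\ 2\ \ldots\ n),\gamma_n\rangle$, where $i\gamma_n=n-i+1$; it is the group of units of $\mathcal{PORI}_n$, dihedral of order $2n$ for $n\ge3$. In two-line notation, the entry $-$ means that the point above is not in the domain. Type (M5): a maximal subsemigroup $M$ of a finite monoid $S$ with $S\setminus M$ contained in the regular $\mathscr{J}$-class $J$ has type (M5) if $M\cap J$ meets every $\mathscr{H}$-class of $J$. *)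

(* Defs.v *)
From HB Require Import structures.
From mathcomp Require Import all_boot.

Set Implicit Arguments.
Unset Strict Implicit.
Unset Printing Implicit Defensive.

(** * The monoid of partial maps

    The point [i] of {1, ..., n} is represented by the ordinal of value [i - 1];
    [a i = None] means that [i] is not in the domain of [a]. *)
Definition pt (n : nat) := {ffun 'I_n -> option 'I_n}.

HB.instance Definition _ (n : nat) := Finite.on (pt n).

Section PartialMaps.
Variable n : nat.
Implicit Types a b c : pt n.

(* Maps are written on the right: [a] is applied first in the product [a * b]. *)
Definition pt_mul a b : pt n := [ffun i => obind b (a i)].
Definition pt_one : pt n := [ffun i => Some i].

Lemma pt_mulA : associative pt_mul.
Proof. by move=> a b c; apply/ffunP=> i; rewrite !ffunE; case: (a i) => //= j; rewrite ffunE. Qed.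

Lemma pt_mul1 : left_id pt_one pt_mul.
Proof. by move=> a; apply/ffunP=> i; rewrite !ffunE. Qed.

Lemma pt_mulr1 : right_id pt_one pt_mul.
Proof. by move=> a; apply/ffunP=> i; rewrite !ffunE; case: (a i) => //= j; rewrite ffunE. Qed.

End PartialMaps.

HB.instance Definition _ (n : nat) := hasMul.Build (pt n) (@pt_mul n).
HB.instance Definition _ (n : nat) :=
  Magma_isSemigroup.Build (pt n) (@pt_mulA n).
HB.instance Definition _ (n : nat) := hasOne.Build (pt n) (pt_one n).
HB.instance Definition _ (n : nat) :=
  Magma_isUMagma.Build (pt n) (@pt_mul1 n) (@pt_mulr1 n).

Section Semigroups.
Variable n : nat.
Implicit Types (A S T M G U J : {set pt n}) (a x y : pt n).

Local Open Scope group_scope.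

Definition subsemigroup T : bool :=
  [forall x in T, forall y in T, x * y \in T].

Definition gen A : {set pt n} :=
  \bigcap_(T : {set pt n} | subsemigroup T && (A \subset T)) T.

Definition maximal_subsemigroup S M : bool :=
  maxset (fun T => subsemigroup T && (T \proper S)) M.

(* Only groups whose identity is that of the ambient monoid are considered. *)
Definition subgroup U : bool :=
  [&& 1 \in U, subsemigroup U
    & [forall x in U, exists y in U, (x * y == 1) && (y * x == 1)]].

Definition maximal_subgroup G U : bool :=
  maxset (fun V => subgroup V && (V \proper G)) U.

(** Green's relations of a submonoid [S]: since [1 \in S], the principal left,
    right and two-sided ideals generated by [x] are [S x], [x S] and [S x S]. *)
Definition lideal S x : {set pt n} := [set s * x | s : pt n in S].
Definition rideal S x : {set pt n} := [set x * s | s : pt n in S].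
Definition ideal S x : {set pt n} := [set s * x * t | s : pt n in S, t : pt n in S].

Definition greenH S x y : bool :=
  (lideal S x == lideal S y) && (rideal S x == rideal S y).
Definition greenJ S x y : bool := ideal S x == ideal S y.

Definition is_Jclass S J : Prop :=
  exists2 x, x \in S & J = [set y in S | greenJ S x y].

Definition regular S J : Prop :=
  forall x, x \in J -> exists2 y, y \in S & x * y * x = x.

Definition type_M5 S M : Prop :=
  maximal_subsemigroup S M /\
  exists J : {set pt n},
    [/\ is_Jclass S J, regular S J, S :\: M \subset J
      & forall x, x \in J -> exists2 y, y \in M :&: J & greenH S x y].

End Semigroups.

Section Monoids.
Variable n : nat.
Implicit Type a : pt n.

Definition pdom a : {set 'I_n} := [set i | a i != None].
Definition pim a : {set 'I_n} := [set j | Some j \in codom a].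

(* [enum 'I_n] is increasing, so for a domain i_1 < ... < i_k this is the
   sequence of the images of i_1, ..., i_k in this order. *)
Definition images a : seq 'I_n := pmap a (enum 'I_n).

(* [zip s (rot 1 s)] lists the pairs of cyclically consecutive entries of [s]. *)
Definition orientation_preserving a : bool :=
  count (fun q : 'I_n * 'I_n => q.2 < q.1) (zip (images a) (rot 1 (images a))) <= 1.
Definition orientation_reversing a : bool :=
  count (fun q : 'I_n * 'I_n => q.1 < q.2) (zip (images a) (rot 1 (images a))) <= 1.

Definition symI : {set pt n} := [set a : pt n | dinjectiveb a (pdom a)].

Definition PORI : {set pt n} :=
  [set a : pt n in symI | orientation_preserving a || orientation_reversing a].

Definition Jn1 : {set pt n} := [set a : pt n | #|pim a| == n.-1].

Definition cyc : pt n := [ffun i => Some (ordS i)].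
Definition gamma : pt n := [ffun i => Some (rev_ord i)].

Definition dihedral : {set pt n} := gen [set cyc; gamma].

(* With points numbered from 0, [zeta] maps i to i + 1 modulo n - 1 and [tau]
   maps i to n - 2 - i, both on the domain {0, ..., n - 2}. *)
Definition zeta : pt n :=
  [ffun i : 'I_n => if i < n.-1 then insub (i.+1 %% n.-1) else None].
Definition tau : pt n :=
  [ffun i : 'I_n => if i < n.-1 then insub (n - 2 - i) else None].

Definition family_a (U : {set pt n}) : {set pt n} := (PORI :\: dihedral) :|: U.
Definition family_b (p : nat) : {set pt n} :=
  gen ((PORI :\: Jn1) :|: [set (zeta ^+ p)%g; tau]).

End Monoids.

(* Main.v *)
Require Import Defs.
From HB Require Import structures.
From mathcomp Require Import all_boot zify.

Set Implicit Arguments.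
Unset Strict Implicit.
Unset Printing Implicit Defensive.

(** An injective partial map preserves (reverses) orientation exactly when it
    preserves (reverses) the ternary cyclic order on its domain ([PORIP]). In
    this form it is clear that [PORI n] is closed under products, and that an
    element whose domain is [{0, ..., m - 1}] and whose image is contained in
    this interval is one of the rotations [i |-> i + k] and reflections
    [i |-> k - i] modulo [m] ([PORI_interval]). For [m = n] these form the group
    of units [D]; for [m = n - 1] they form a group [H] whose identity is the
    partial identity [e] undefined at the last point. The notation [D], [H] and
    [e] is kept below.

    Every element is a product of units and elements of rank [n - 1]
    ([gen_PORI]): multiplying by partial identities that are moved at one point,
    one pushes the domain and the image of an element down to an initial
    interval, where only rotations and reflections remain. Hence a proper
    subsemigroup [T] either misses a unit or misses an element of rank [n - 1].

    If [T] misses a unit then [T :&: D] is a proper subsemigroup of the dihedral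
    group [D], and [T] is contained in the set [family_a U] for some maximal
    subgroup [U] of [D] containing [T :&: D]; these sets are subsemigroups
    because the non-units form an ideal. The subgroups [U] are the group of
    rotations and, for each prime [p] dividing [n], the [p] dihedral subgroups
    of index [p] ([dihset_proper]).

    If [T] contains [D], then each element of rank [n - 1] can be moved into [H]
    by multiplying by units on both sides ([rank_pred_transport]), so [T] is
    controlled by the proper subsemigroup [T :&: H] of the group [H]. If this
    is not empty it contains [e] and the product [tau n] of [e] and the
    reflection fixing the last point. For [n >= 4] it lies therefore in the
    unique dihedral subgroup of index [p] of [H] that contains [tau n], for some
    prime [p] dividing [n - 1], and [T] is contained in the corresponding
    subsemigroup [Bset n p], which is [family_b n p] ([family_bE]). That
    [Bset n p] is closed rests on the fact that a unit preserving the first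
    [n - 1] points is trivial on them or acts there as [tau n]
    ([unit_stab_interval]). For [n = 3] the group [H] is [{e, tau n}], so
    [T :&: H] is empty and the only maximal subsemigroup containing [D] is the
    complement of the elements of rank two.

    The sets obtained are pairwise incomparable, so they are exactly the maximal
    subsemigroups ([maxset_antichain]). *)

(** * Cyclic descents and the cyclic order *)

(** The ternary cyclic order of the natural numbers: going upwards and
    cyclically from [x], one meets [y] strictly before [z]. *)
Definition cyc3 (x y z : nat) : bool :=
  [|| x < y < z, y < z < x | z < x < y].

Lemma count_le1P (T : eqType) (P : pred T) (s : seq T) : uniq s ->
  count P s <= 1 <-> {in s &, forall i j, P i -> P j -> i = j}.
Proof.
move=> us; rewrite -size_filter; have := filter_uniq P us.
have Em x : (x \in filter P s) = P x && (x \in s) by rewrite mem_filter.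
case: (filter P s) Em => [|x [|y t]] Em uf; split=> //.
- by move=> _ i j si _ Pi _; have := Em i; rewrite Pi si.
- move=> _ i j si sj Pi Pj; have := Em i; have := Em j.
  by rewrite Pi Pj si sj !inE => /eqP-> /eqP->.
move=> H; move: uf; rewrite /= inE negb_or => /andP[/andP[/eqP nxy _] _].
have /andP[Px sx]: P x && (x \in s) by rewrite -Em inE eqxx.
have /andP[Py sy]: P y && (y \in s) by rewrite -Em !inE eqxx orbT.
by case: nxy; apply: H.
Qed.

(** The entry of index [i] is followed, cyclically, by a smaller one. *)
Definition cdescent (s : seq nat) (i : nat) : bool :=
  nth 0 s (i.+1 %% size s) < nth 0 s i.

Lemma count_cdescent (s : seq nat) :
  count (fun q : nat * nat => q.2 < q.1) (zip s (rot 1 s)) =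
  count (cdescent s) (iota 0 (size s)).
Proof.
have ->: zip s (rot 1 s) =
    map (fun i => (nth 0 s i, nth 0 s (i.+1 %% size s))) (iota 0 (size s)).
  apply: (@eq_from_nth _ (0, 0)).
    by rewrite size_zip size_rot minnn size_map size_iota.
  move=> i; rewrite size_zip size_rot minnn => lti.
  rewrite nth_zip ?size_rot // (nth_map 0) ?size_iota // nth_iota // add0n.
  congr pair; rewrite /rot nth_cat size_drop.
  case: s lti => // x s' /= lti; rewrite subn1 /= drop0.
  case: ltnP => h; first by rewrite modn_small //= ltnS.
  have ->: i = size s' by lia.
  by rewrite subnn modnn.
by rewrite count_map.
Qed.

Lemma descent_between (s : seq nat) i j :
  i < j -> j < size s -> nth 0 s j < nth 0 s i ->
  exists2 p, i <= p < j & cdescent s p.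
Proof.
elim: j => // j IH; rewrite ltnS leq_eqVlt => /orP[/eqP->|ij] jK d.
  by exists j; [lia|rewrite /cdescent modn_small].
case: (boolP (cdescent s j)) => [dj|]; first by exists j => //; lia.
rewrite /cdescent modn_small // -leqNgt => le.
by have [||p ? dp] := IH ij; [lia|lia|exists p => //; lia].
Qed.

Lemma descent_around (s : seq nat) i k :
  i < k -> k < size s -> nth 0 s i < nth 0 s k ->
  exists2 p, (p < i) || (k <= p < size s) & cdescent s p.
Proof.
move=> ik kK d.
have sK : (size s).-1.+1 = size s by lia.
case: (boolP (cdescent s (size s).-1)) => [dj|].
  by exists (size s).-1 => //; lia.
rewrite /cdescent sK modnn -leqNgt => le.
have [h|h] := ltnP (nth 0 s (size s).-1) (nth 0 s k).
  have [||p ? dp] := @descent_between s k (size s).-1 _ _ h; [|lia|].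
    by case: (eqVneq k (size s).-1) h => [->|]; lia.
  by exists p => //; lia.
have h0 : nth 0 s i < nth 0 s 0 by lia.
have [||p ? dp] := @descent_between s 0 i _ _ h0; [|lia|].
  by case: i h0 {ik d} => //; lia.
by exists p => //; lia.
Qed.

(** A duplicate-free sequence has at most one cyclic descent exactly when
    it lists its entries in cyclic order. *)
Lemma cdescent_cyc3 (s : seq nat) : uniq s ->
  count (fun q : nat * nat => q.2 < q.1) (zip s (rot 1 s)) <= 1 <->
  (forall i j k, i < j -> j < k -> k < size s ->
     cyc3 (nth 0 s i) (nth 0 s j) (nth 0 s k)).
Proof.
move=> us; rewrite count_cdescent count_le1P ?iota_uniq //.
have nq i j : i < j -> j < size s -> nth 0 s i <> nth 0 s j.
  move=> ij jK /eqP; rewrite nth_uniq //; first by move/eqP; lia.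
  exact: ltn_trans jK.
split=> [H i j k ij jk kK|H].
  have {}H p q : p < q -> q < size s -> cdescent s p -> cdescent s q -> False.
    move=> pq qK dp dq; have: p = q; last by lia.
    by apply: H; rewrite ?mem_iota //=; lia.
  have nij := nq i j ij (ltn_trans jk kK).
  have njk := nq j k jk kK; have nik := nq i k (ltn_trans ij jk) kK.
  (* Two of the three pairs (i, j), (j, k), (k, i) are inverted, and each
     inversion forces a cyclic descent in the corresponding cyclic interval. *)
  apply/negPn/negP => nC.
  have [dij|dij] := ltnP (nth 0 s j) (nth 0 s i).
    have [p ? dp] := descent_between ij (ltn_trans jk kK) dij.
    have [djk|djk] := ltnP (nth 0 s k) (nth 0 s j).
      have [q ? dq] := descent_between jk kK djk.
      by apply: (H p q) => //; lia.
    have dik : nth 0 s i < nth 0 s k by move: nC; rewrite /cyc3; lia.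
    have [q ? dq] := descent_around (ltn_trans ij jk) kK dik.
    by have [h|h] := ltnP p q; [apply: (H p q)|apply: (H q p)] => //; lia.
  have djk : nth 0 s k < nth 0 s j by move: nC; rewrite /cyc3; lia.
  have dik : nth 0 s i < nth 0 s k by move: nC; rewrite /cyc3; lia.
  have [p ? dp] := descent_between jk kK djk.
  have [q ? dq] := descent_around (ltn_trans ij jk) kK dik.
  by have [h|h] := ltnP p q; [apply: (H p q)|apply: (H q p)] => //; lia.
have {}H p q : p < q -> q < size s -> cdescent s p -> cdescent s q -> False.
  rewrite /cdescent => pq qK; rewrite modn_small; last lia.
  case: (eqVneq q.+1 (size s)) => [qe|qe].
    rewrite qe modnn => dp dq.
    have [e|p1q] := eqVneq p.+1 q.
      subst q; case: p pq dp dq qK qe => [|p] pq dp dq qK qe; first by lia.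
      by have := H 0 p.+1 p.+2; rewrite /cyc3; lia.
    have := H p p.+1 q; case: p pq dp dq p1q => [|p] pq dp dq p1q.
      by rewrite /cyc3; lia.
    by have := H 0 p.+1 q; have := H 0 p.+2 q; rewrite /cyc3; lia.
  rewrite modn_small; last lia.
  have [e|p1q] := eqVneq p.+1 q => dp dq.
    by subst q; have := H p p.+1 p.+2; rewrite /cyc3; lia.
  have := H p p.+1 q; have := H p q q.+1; rewrite /cyc3; lia.
move=> p q; rewrite !mem_iota /= !add0n => pK qK dp dq.
by case: (ltngtP p q) => // h; [case: (H p q)|case: (H q p)].
Qed.

(** * Values of partial maps *)

Section Values.
Variable n : nat.
Implicit Types a b c : pt n.

(** The value of a partial map at a natural number, with [n] standing for
    undefined; with this convention [av (a * b) = av b \o av a]. *)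
Definition av a (i : nat) : nat :=
  if insub i is Some i' then (if a i' is Some j then val j else n) else n.

(** The partial map whose values are those of [f] that are less than [n]. *)
Definition of_fun (f : nat -> nat) : pt n := [ffun i : 'I_n => insub (f i)].

Lemma av_ord a (i : 'I_n) : av a i = if a i is Some j then val j else n.
Proof. by rewrite /av valK. Qed.

Lemma av_out a i : n <= i -> av a i = n.
Proof. by move=> h; rewrite /av insubF // ltnNge h. Qed.

Lemma av_le a i : av a i <= n.
Proof.
by rewrite /av; case: insub => [j|] //; case: (a j) => //= k; apply: ltnW.
Qed.

Lemma av_dom a i : av a i < n -> i < n.
Proof. by apply: contraLR; rewrite -!leqNgt => /av_out->. Qed.

Lemma av_mul a b i : av (a * b)%g i = av b (av a i).
Proof.
rewrite {1 3}/av; case: insub => [i'|]; last by rewrite av_out.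
rewrite [(a * b)%g]/(pt_mul a b) ffunE; case: (a i') => [j|] /=.
  by rewrite av_ord.
by rewrite av_out.
Qed.

Lemma av_one i : i < n -> av 1%g i = i.
Proof.
by move=> h; rewrite -[i]/(val (Ordinal h)) av_ord [1%g]/(pt_one n) ffunE.
Qed.

Lemma av_of_fun f i : i < n -> f i <= n -> av (of_fun f) i = f i.
Proof.
move=> h fle; rewrite -[i in LHS]/(val (Ordinal h)) av_ord ffunE /=.
by case: insubP => [j _ ->//|]; lia.
Qed.

Lemma pt_eq a b : (forall i, i < n -> av a i = av b i) -> a = b.
Proof.
move=> H; apply/ffunP => i; have := H i (ltn_ord i); rewrite !av_ord.
case: (a i) => [x|]; case: (b i) => [y|] //.
- by move/val_inj->.
- by have := ltn_ord x => /[swap] ->; rewrite ltnn.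
- by have := ltn_ord y => /[swap] <-; rewrite ltnn.
Qed.

Lemma symIP a :
  a \in symI n <-> (forall i j, av a i = av a j -> av a i < n -> i = j).
Proof.
rewrite inE; split.
  move=> /dinjectiveP H.
  have {}H (x y : 'I_n) : av a x = av a y -> av a x < n -> x = y.
    move=> e lt; have := H x y; rewrite !inE; move: e lt; rewrite !av_ord.
    case: (a x) => [u|]; case: (a y) => [w|] e lt; try lia.
    by rewrite (val_inj e); exact.
  move=> i j e lt; have hi := av_dom lt; have hj : j < n.
    by apply: (@av_dom a); rewrite -e.
  by have /(congr1 val) := H (Ordinal hi) (Ordinal hj) e lt.
move=> H; apply/dinjectiveP => i j; rewrite !inE => ai aj e.
apply/val_inj/H; rewrite !av_ord e //.
by move: aj; case: (a j) => //= x _; apply: ltn_ord.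
Qed.

Lemma map_images a : map val (images a) =
  map (av a) (filter (fun x => av a x < n) (iota 0 n)).
Proof.
rewrite -val_enum_ord /images; elim: (enum 'I_n) => //= i s IH.
rewrite av_ord; case E : (a i) => [x|] /=; last by rewrite ltnn.
by rewrite ltn_ord /= IH av_ord E.
Qed.

End Values.

(** * The cyclic order and [PORI n] *)

(** Here [E] stands for the increasing list of the points of a domain. *)
Lemma cdescent_sorted (E : seq nat) (f : nat -> nat) :
  sorted ltn E -> {in E &, injective f} ->
  count (fun q : nat * nat => q.2 < q.1) (zip (map f E) (rot 1 (map f E))) <= 1
  <-> {in E & &, forall x y z, x < y -> y < z -> cyc3 (f x) (f y) (f z)}.
Proof.
move=> sE fI.
have uE : uniq E by apply: sorted_uniq sE; [apply: ltn_trans|apply: ltnn].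
rewrite cdescent_cyc3 ?map_inj_in_uniq // size_map; split=> H.
  move=> x y z Ex Ey Ez xy yz.
  have ltx : {in E &, forall u w, u < w -> index u E < index w E}.
    move=> u w Eu Ew; apply: contraTltn; rewrite -leqNgt leq_eqVlt.
    case/orP=> [/eqP e|wu].
      by rewrite -(nth_index 0 Eu) -e nth_index // ltnn.
    have := sorted_ltn_nth ltn_trans 0 sE; move=> /(_ (index w E) (index u E)).
    by rewrite !inE !index_mem !nth_index // => /(_ Ew Eu wu); lia.
  have := H _ _ _ (ltx _ _ Ex Ey xy) (ltx _ _ Ey Ez yz).
  by rewrite index_mem !(nth_map 0) ?index_mem // !nth_index //; apply.
move=> i j k ij jk kE; have jE := ltn_trans jk kE; have iE := ltn_trans ij jE.
rewrite !(nth_map 0) //.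
by apply: H; rewrite ?mem_nth // ?(sorted_ltn_nth ltn_trans).
Qed.

Section Orientation.
Variable n : nat.
Implicit Types a b c : pt n.

(** Preservation and reversal of the cyclic order on the domain. *)
Definition cyc_pres a : Prop := forall i j k,
  av a i < n -> av a j < n -> av a k < n ->
  cyc3 i j k -> cyc3 (av a i) (av a j) (av a k).

Definition cyc_rev a : Prop := forall i j k,
  av a i < n -> av a j < n -> av a k < n ->
  cyc3 i j k -> cyc3 (av a k) (av a j) (av a i).

Let dom a := [seq x <- iota 0 n | av a x < n].

Lemma sorted_dom a : sorted ltn (dom a).
Proof. by apply: sorted_filter (iota_ltn_sorted 0 n); apply: ltn_trans. Qed.

Lemma mem_dom a x : (x \in dom a) = (av a x < n).
Proof.
by rewrite mem_filter mem_iota add0n; apply: andb_idr => /av_dom.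
Qed.

Lemma count_zip_rot (T1 T2 : Type) (f : T1 -> T2) (P : pred (T2 * T2))
    (s : seq T1) :
  count (fun q => P (f q.1, f q.2)) (zip s (rot 1 s)) =
  count P (zip (map f s) (rot 1 (map f s))).
Proof.
rewrite -map_rot; elim: s (rot 1 s) => [|x s IH] [|y t] //=.
by rewrite IH.
Qed.

Lemma orientation_preservingP a : a \in symI n ->
  orientation_preserving a <-> cyc_pres a.
Proof.
move=> /symIP aI; rewrite /orientation_preserving.
have -> := count_zip_rot (@nat_of_ord n) (fun q => q.2 < q.1) (images a).
rewrite map_images cdescent_sorted ?sorted_dom //; last first.
  by move=> x y; rewrite mem_dom => h _ e; apply: aI.
split=> [H i j k ai aj ak C|H i j k].
  have := H i j k; have := H j k i; have := H k i j.
  by rewrite -/(dom a) !mem_dom; move: C; rewrite /cyc3; lia.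
rewrite -/(dom a) !mem_dom => ai aj ak ij jk.
by apply: H => //; rewrite /cyc3 ij jk.
Qed.

Lemma orientation_reversingP a : a \in symI n ->
  orientation_reversing a <-> cyc_rev a.
Proof.
move=> /symIP aI; rewrite /orientation_reversing.
pose f (x : 'I_n) := n - x.
have := count_zip_rot f (fun q => q.2 < q.1) (images a).
rewrite (eq_count (a2 := fun q : 'I_n * 'I_n => q.1 < q.2)); last first.
  by move=> [x y] /=; rewrite /f; have := ltn_ord x; have := ltn_ord y; lia.
move->; rewrite (map_comp (fun x => n - x) val) map_images -map_comp.
rewrite cdescent_sorted ?sorted_dom //; last first.
  move=> x y; rewrite !mem_dom => h1 h2 /= e; apply: aI => //; lia.
split=> [H i j k ai aj ak C|H i j k].
  have := H i j k; have := H j k i; have := H k i j.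
  by rewrite -/(dom a) !mem_dom; move: C; rewrite /cyc3 /=; lia.
rewrite -/(dom a) !mem_dom => ai aj ak ij jk.
have := H i j k ai aj ak; rewrite /cyc3 /= ij jk; lia.
Qed.

Lemma PORIP a : a \in PORI n <->
  (forall i j, av a i = av a j -> av a i < n -> i = j) /\
  (cyc_pres a \/ cyc_rev a).
Proof.
rewrite inE; split.
  move=> /andP[aI /orP O]; split; first exact/symIP.
  by case: O => O; [left; apply/orientation_preservingP
                   |right; apply/orientation_reversingP].
move=> [/symIP aI O]; rewrite aI /=; apply/orP.
by case: O => O; [left; apply/orientation_preservingP
                   |right; apply/orientation_reversingP].
Qed.

Lemma PORI_inj a : a \in PORI n ->
  forall i j, av a i = av a j -> av a i < n -> i = j.
Proof. by case/PORIP. Qed.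

Lemma cyc_pres_mul a b : cyc_pres a -> cyc_pres b -> cyc_pres (a * b)%g.
Proof.
move=> A B i j k; rewrite !av_mul => bi bj bk C.
by apply: B => //; apply: A => //; apply: av_dom; eassumption.
Qed.

Lemma cyc_pres_rev_mul a b : cyc_pres a -> cyc_rev b -> cyc_rev (a * b)%g.
Proof.
move=> A B i j k; rewrite !av_mul => bi bj bk C.
by apply: B => //; apply: A => //; apply: av_dom; eassumption.
Qed.

Lemma cyc_rev_pres_mul a b : cyc_rev a -> cyc_pres b -> cyc_rev (a * b)%g.
Proof.
move=> A B i j k; rewrite !av_mul => bi bj bk C.
by apply: B => //; apply: A => //; apply: av_dom; eassumption.
Qed.

Lemma cyc_rev_mul a b : cyc_rev a -> cyc_rev b -> cyc_pres (a * b)%g.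
Proof.
move=> A B i j k; rewrite !av_mul => bi bj bk C.
by apply: B => //; apply: A => //; apply: av_dom; eassumption.
Qed.

Lemma PORI_mul a b : a \in PORI n -> b \in PORI n -> (a * b)%g \in PORI n.
Proof.
move=> /PORIP[aI aO] /PORIP[bI bO]; apply/PORIP; split.
  move=> i j; rewrite !av_mul => e lt; have h := av_dom lt.
  exact: aI (bI _ _ e lt) h.
case: aO => A; case: bO => B.
- by left; apply: cyc_pres_mul.
- by right; apply: cyc_pres_rev_mul.
- by right; apply: cyc_rev_pres_mul.
- by left; apply: cyc_rev_mul.
Qed.

Lemma PORI_one : 1%g \in PORI n.
Proof.
apply/PORIP; split=> [i j|].
  move=> e lt; have hi := av_dom lt.
  have hj : j < n by apply: (@av_dom _ 1%g); rewrite -e.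
  by move: e; rewrite !av_one.
by left=> i j k hi hj hk; rewrite !av_one //; apply: av_dom; eassumption.
Qed.

Lemma cyc3_small i j k : i < 3 -> j < 3 -> k < 3 -> cyc3 i j k ->
  [\/ [/\ i = 0, j = 1 & k = 2], [/\ i = 1, j = 2 & k = 0]
    | [/\ i = 2, j = 0 & k = 1]].
Proof.
by case: i => [|[|[|i]]] //; case: j => [|[|[|j]]] //;
  case: k => [|[|[|k]]] // _ _ _; rewrite /cyc3 //= => _;
  (by constructor 1) || (by constructor 2) || (by constructor 3).
Qed.

(** On at most three points there is no orientation to respect. *)
Lemma PORI_small : n <= 3 -> PORI n = symI n.
Proof.
move=> n3; apply/setP => a; apply/idP/idP; first by rewrite inE => /andP[].
move=> /symIP aI; apply/PORIP; split=> //.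
have [C|nC] := boolP (cyc3 (av a 0) (av a 1) (av a 2)).
  left=> i j k ai aj ak c.
  have := av_dom ai; have := av_dom aj; have := av_dom ak => hi hj hk.
  have : [\/ [/\ i = 0, j = 1 & k = 2], [/\ i = 1, j = 2 & k = 0]
          | [/\ i = 2, j = 0 & k = 1]] by apply: cyc3_small c; lia.
  by case=> -[-> -> ->]; move: C; rewrite /cyc3; lia.
right=> i j k ai aj ak c.
have := av_dom ai; have := av_dom aj; have := av_dom ak => hi hj hk.
have := aI i j; have := aI j k; have := aI i k.
have : [\/ [/\ i = 0, j = 1 & k = 2], [/\ i = 1, j = 2 & k = 0]
          | [/\ i = 2, j = 0 & k = 1]] by apply: cyc3_small c; lia.
by case=> -[? ? ?]; subst; move: nC ai aj ak; rewrite /cyc3; lia.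
Qed.

End Orientation.

(** * Rotations and reflections *)

(** Modulo [m], and modulo each divisor [p] of [m], multiplication by [m.-1] is
    the change of sign. *)
Lemma modn_addN m p x k : 0 < m -> p %| m -> x + (k + m.-1 * k) = x %[mod p].
Proof.
by case: m => //= m _ pm; rewrite -mulSn -modnDmr (eqP (dvdn_mulr k pm)) addn0.
Qed.

Lemma modn_addNl m p x y k : 0 < m -> p %| m ->
  x + m.-1 * k = y %[mod p] <-> x = y + k %[mod p].
Proof.
move=> m0 pm; have e : x + m.-1 * k + k = x %[mod p].
  by rewrite -addnA (addnC (_ * k)) (modn_addN x k m0 pm).
split=> [H|H]; first by rewrite -e -modnDml H modnDml.
by apply/eqP; rewrite -(eqn_modDr k) e H.
Qed.

Lemma dvdn_addNl m p x k : 0 < m -> p %| m ->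
  p %| x + m.-1 * k <-> x = k %[mod p].
Proof.
move=> m0 pm; rewrite -[k in RHS]add0n -(modn_addNl x 0 k m0 pm) mod0n.
by split=> [/eqP|/eqP].
Qed.

Lemma modn_shift m x k : x < m -> k < m ->
  (x + k) %% m = if x + k < m then x + k else x + k - m.
Proof.
move=> xm km; case: ltnP => h; first by rewrite modn_small.
by rewrite -{1}(subnK h) modnDr modn_small //; lia.
Qed.

Lemma modn_flip m x k : x < m -> k < m ->
  (k + m.-1 * x) %% m = if x <= k then k - x else k + m - x.
Proof.
move=> xm km; have m0 : 0 < m by lia.
set r := RHS; have rm : r < m by rewrite /r; case: ifP => ?; lia.
rewrite -(modn_small rm); apply/modn_addNl => //.
rewrite /r; case: ifP => h; first by rewrite subnK.
by rewrite subnK ?modnDr //; lia.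
Qed.

Section Dihedral.
Variable n : nat.
Implicit Types a b c : pt n.

(** The rotation [i |-> i + k] and the reflection [i |-> k - i] modulo [m],
    both with domain the first [m] points; they are used for [m <= n]. The
    negative is written as multiplication by [m.-1], so that the composition
    rules below involve no subtraction. *)
Definition rotm m k : pt n :=
  of_fun n (fun i => if i < m then (i + k) %% m else n).
Definition refm m k : pt n :=
  of_fun n (fun i => if i < m then (k + m.-1 * i) %% m else n).

Lemma av_rotm m k i : m <= n ->
  av (rotm m k) i = if i < m then (i + k) %% m else n.
Proof.
move=> mn; have [h|h] := ltnP i n; last by rewrite av_out // ifF //; lia.
rewrite av_of_fun //; case: ifP => // im.
by have := ltn_mod (i + k) m; lia.
Qed.

Lemma av_refm m k i : m <= n ->
  av (refm m k) i = if i < m then (k + m.-1 * i) %% m else n.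
Proof.
move=> mn; have [h|h] := ltnP i n; last by rewrite av_out // ifF //; lia.
rewrite av_of_fun //; case: ifP => // im.
by have := ltn_mod (k + m.-1 * i) m; lia.
Qed.

Lemma rotm_mod m j k : m <= n -> j = k %[mod m] -> rotm m j = rotm m k.
Proof.
move=> mn e; apply: pt_eq => i _; rewrite !av_rotm //; case: ifP => // _.
by rewrite -modnDmr e modnDmr.
Qed.

Lemma refm_mod m j k : m <= n -> j = k %[mod m] -> refm m j = refm m k.
Proof.
move=> mn e; apply: pt_eq => i _; rewrite !av_refm //; case: ifP => // _.
by rewrite -modnDml e modnDml.
Qed.

Let modlt m i x : i < m -> x %% m < m.
Proof. by rewrite ltn_mod; lia. Qed.

Lemma rotm_rotm m j k : m <= n -> (rotm m j * rotm m k)%g = rotm m (j + k).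
Proof.
move=> mn; apply: pt_eq => i _; rewrite av_mul !av_rotm //.
case: (ltnP i m) => im; last by rewrite ifF //; lia.
by rewrite (modlt _ im) modnDml addnA.
Qed.

Lemma rotm_refm m j k : m <= n ->
  (rotm m j * refm m k)%g = refm m (k + m.-1 * j).
Proof.
move=> mn; apply: pt_eq => i _; rewrite av_mul !av_refm // av_rotm //.
case: (ltnP i m) => im; last by rewrite ifF //; lia.
rewrite (modlt _ im) -modnDmr modnMmr modnDmr; congr (_ %% _).
by rewrite mulnDr; lia.
Qed.

Lemma refm_rotm m j k : m <= n -> (refm m j * rotm m k)%g = refm m (j + k).
Proof.
move=> mn; apply: pt_eq => i _; rewrite av_mul !av_rotm // !av_refm //.
case: (ltnP i m) => im; last by rewrite ifF //; lia.
by rewrite (modlt _ im) modnDml addnAC.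
Qed.

Lemma refm_refm m j k : m <= n ->
  (refm m j * refm m k)%g = rotm m (k + m.-1 * j).
Proof.
move=> mn; apply: pt_eq => i _; rewrite av_mul !av_refm // av_rotm //.
case: (ltnP i m) => im; last by rewrite ifF //; lia.
have m0 : 0 < m by lia.
rewrite (modlt _ im) -modnDmr modnMmr modnDmr.
apply/(modn_addNl k (i + (k + m.-1 * j)) (j + m.-1 * i) m0 (dvdnn m)).
have -> : i + (k + m.-1 * j) + (j + m.-1 * i) =
          k + (j + m.-1 * j) + (i + m.-1 * i) by lia.
by rewrite !(modn_addN _ _ m0 (dvdnn m)).
Qed.

Lemma rotm0_av m i : m <= n -> i < m -> av (rotm m 0) i = i.
Proof. by move=> mn im; rewrite av_rotm // im addn0 modn_small. Qed.

Lemma rotm_id m k : m <= n -> m %| k -> rotm m k = rotm m 0.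
Proof. by move=> mn /eqP h; apply: rotm_mod; rewrite ?h ?mod0n. Qed.

Lemma rotmV m k : 0 < m <= n ->
  (rotm m k * rotm m (m.-1 * k))%g = rotm m 0 /\
  (rotm m (m.-1 * k) * rotm m k)%g = rotm m 0.
Proof.
move=> /andP[m0 mn]; rewrite !rotm_rotm //; split; apply: rotm_mod => //.
  exact: (modn_addN 0).
by rewrite addnC; apply: (modn_addN 0).
Qed.

Lemma refmV m k : 0 < m <= n -> (refm m k * refm m k)%g = rotm m 0.
Proof.
move=> /andP[m0 mn]; rewrite refm_refm //; apply: rotm_mod => //.
exact: (modn_addN 0).
Qed.

Lemma rotm_inj m j k : 0 < m <= n -> rotm m j = rotm m k -> j = k %[mod m].
Proof.
move=> /andP[m0 mn] /(congr1 (fun a => av a 0)).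
by rewrite !av_rotm // m0.
Qed.

Lemma refm_inj m j k : 0 < m <= n -> refm m j = refm m k -> j = k %[mod m].
Proof.
move=> /andP[m0 mn] /(congr1 (fun a => av a 0)).
by rewrite !av_refm // m0 muln0 !addn0.
Qed.

Lemma rotm_neq_refm m j k : 3 <= m <= n -> rotm m j <> refm m k.
Proof.
move=> /andP[m3 mn].
have jm := ltn_pmod j (ltn_trans (ltn0Sn 1) m3).
have km := ltn_pmod k (ltn_trans (ltn0Sn 1) m3).
rewrite -(rotm_mod mn (modn_mod j m)) -(refm_mod mn (modn_mod k m)) => H.
have := congr1 (fun a => av a 0) H; have := congr1 (fun a => av a 1) H.
rewrite !av_refm // !av_rotm // !ifT; try lia.
rewrite !modn_shift ?modn_flip //; try lia.
by do !case: ifP => ?; lia.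
Qed.

Lemma rotm_cyc_pres m k : m <= n -> cyc_pres (rotm m k).
Proof.
move=> mn x y z; rewrite !av_rotm //.
case: (ltnP x m) => [xm|_]; last by rewrite ltnn.
case: (ltnP y m) => [ym|_]; last by rewrite ltnn.
case: (ltnP z m) => [zm|_]; last by rewrite ltnn.
have km : k %% m < m by rewrite ltn_mod; lia.
rewrite -(modnDmr x) -(modnDmr y) -(modnDmr z) !modn_shift //.
by rewrite /cyc3; do !case: ifP => ?; lia.
Qed.

Lemma refm_cyc_rev m k : m <= n -> cyc_rev (refm m k).
Proof.
move=> mn x y z; rewrite !av_refm //.
case: (ltnP x m) => [xm|_]; last by rewrite ltnn.
case: (ltnP y m) => [ym|_]; last by rewrite ltnn.
case: (ltnP z m) => [zm|_]; last by rewrite ltnn.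
have km : k %% m < m by rewrite ltn_mod; lia.
rewrite -!(modnDml k) !modn_flip //.
by rewrite /cyc3; do !case: ifP => ?; lia.
Qed.

Lemma rotm_PORI m k : m <= n -> rotm m k \in PORI n.
Proof.
move=> mn; apply/PORIP; split; last by left; apply: rotm_cyc_pres.
move=> x y; rewrite !av_rotm //.
case: (ltnP x m) => [xm|_]; last by rewrite ltnn.
case: (ltnP y m) => [ym|_]; last by move=> ->; rewrite ltnn.
have km : k %% m < m by rewrite ltn_mod; lia.
rewrite -(modnDmr x) -(modnDmr y) !modn_shift //.
by do !case: ifP => ?; lia.
Qed.

Lemma refm_PORI m k : m <= n -> refm m k \in PORI n.
Proof.
move=> mn; apply/PORIP; split; last by right; apply: refm_cyc_rev.
move=> x y; rewrite !av_refm //.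
case: (ltnP x m) => [xm|_]; last by rewrite ltnn.
case: (ltnP y m) => [ym|_]; last by move=> ->; rewrite ltnn.
have km : k %% m < m by rewrite ltn_mod; lia.
rewrite -!(modnDml k) !modn_flip //.
by do !case: ifP => ?; lia.
Qed.

Lemma rotm_one : rotm n 0 = 1%g.
Proof. by apply: pt_eq => i h; rewrite rotm0_av // av_one. Qed.

Lemma cycE : cyc n = rotm n 1.
Proof.
apply: pt_eq => i h; rewrite av_rotm // h addn1.
by rewrite -[i in LHS]/(val (Ordinal h)) av_ord ffunE.
Qed.

Lemma gammaE : gamma n = refm n n.-1.
Proof.
apply: pt_eq => i h; rewrite av_refm // h.
rewrite -[i in LHS]/(val (Ordinal h)) av_ord ffunE /= modn_flip ?ifT //; lia.
Qed.

Lemma zetaE : zeta n = rotm n.-1 1.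
Proof.
apply: pt_eq => i h; rewrite av_rotm ?leq_pred //.
rewrite -[i in LHS]/(val (Ordinal h)) av_ord ffunE /= addn1.
case: ifP => // im; case: insubP => [j _ ->//|].
by have := ltn_mod i.+1 n.-1; lia.
Qed.

Lemma tauE : tau n = refm n.-1 n.-2.
Proof.
apply: pt_eq => i h; rewrite av_refm ?leq_pred //.
rewrite -[i in LHS]/(val (Ordinal h)) av_ord ffunE /=.
case: ifP => // im; rewrite modn_flip ?ifT; try lia.
by case: insubP => [j _ ->|] /=; lia.
Qed.

End Dihedral.

Lemma increasing_id m (f : nat -> nat) :
  (forall i, i < m -> f i < m) ->
  (forall i j, i < j -> j < m -> f i < f j) -> forall i, i < m -> f i = i.
Proof.
move=> fm fI; have lo i : i < m -> i <= f i.
  by elim: i => // i IH im; have := fI i i.+1; have := IH; lia.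
have hi j i : i + j.+1 = m -> f i <= i.
  elim: j i => [|j IH] i e; first by have := fm i; lia.
  by have := IH i.+1; have := fI i i.+1; lia.
by move=> i im; have := lo i; have := hi (m - i.+1) i; lia.
Qed.

Section DihedralSets.
Variable n : nat.
Implicit Types (a b : pt n) (X : {set pt n}).

(** An injective map of an initial interval into itself that preserves the cyclic
    order and fixes [0] is increasing, hence the identity. *)
Lemma cyc_pres_fix0 m a : m <= n -> (forall i, i < m -> av a i < m) ->
  cyc_pres a -> (forall i j, av a i = av a j -> av a i < n -> i = j) ->
  av a 0 = 0 -> forall i, i < m -> av a i = i.
Proof.
move=> mn am aP aI a0; apply: increasing_id => // i j ij jm.
have im := ltn_trans ij jm; have hi := am i im; have hj := am j jm.
case: i ij im hi => [|i] ij im hi.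
  by have := aI 0 j; rewrite a0; lia.
by have := aP 0 i.+1 j; rewrite a0 /cyc3; lia.
Qed.

(** The elements of [PORI n] acting on the first [m] points. *)
Lemma PORI_interval m a : m <= n -> a \in PORI n ->
  (forall i, i < m -> av a i < m) -> (forall i, m <= i -> av a i = n) ->
  exists k, a = rotm n m k \/ a = refm n m k.
Proof.
move=> mn aS am ao.
case: (posnP m) => [m0|m0].
  by exists 0; left; apply: pt_eq => i _; rewrite av_rotm // ao m0.
have main b : b \in PORI n -> cyc_pres b -> (forall i, i < m -> av b i < m) ->
    (forall i, m <= i -> av b i = n) -> exists k, b = rotm n m k.
  move=> bS bP bm bo; exists (av b 0).
  (* Compose with the rotation taking the image of 0 back to 0. *)
  pose c := (b * rotm n m (m.-1 * av b 0))%g.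
  have cm i : i < m -> av c i < m.
    by move=> im; rewrite av_mul av_rotm // bm // ltn_mod.
  have c0 : av c 0 = 0.
    rewrite av_mul av_rotm // bm //.
    by have := modn_addN 0 (av b 0) m0 (dvdnn m); rewrite add0n mod0n.
  have cid : forall i, i < m -> av c i = i.
    apply: (cyc_pres_fix0 mn cm) => //.
      by apply: cyc_pres_mul => //; apply: rotm_cyc_pres.
    by apply: PORI_inj; apply: PORI_mul => //; apply: rotm_PORI.
  apply: pt_eq => i _; rewrite av_rotm //; case: ltnP => im; last exact: bo.
  rewrite -{2}(cid i im) av_mul av_rotm // bm // modnDml -addnA.
  by rewrite (addnC (m.-1 * _)) (modn_addN _ _ m0 (dvdnn m)) modn_small ?bm.
case/PORIP: (aS) => _ [aP|aR].
  by case: (main a aS aP am ao) => k ->; exists k; left.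
(* A reflection turns an orientation-reversing map into a preserving one. *)
pose r := refm n m 0; pose b := (a * r)%g.
have [k bE] : exists k, b = rotm n m k.
  apply: main.
  - by apply: PORI_mul => //; apply: refm_PORI.
  - by apply: cyc_rev_mul => //; apply: refm_cyc_rev.
  - by move=> i im; rewrite av_mul av_refm // am // ltn_mod.
  by move=> i im; rewrite av_mul ao // av_out.
exists (m.-1 * k); right.
have -> : a = (b * r)%g.
  rewrite -mulgA refmV ?m0 //; apply: pt_eq => i _; rewrite av_mul.
  case: (ltnP i m) => im; last by rewrite ao // av_out.
  by rewrite rotm0_av ?am.
by rewrite bE rotm_refm // add0n.
Qed.

(** The group of rotations of the first [m] points. *)
Definition rotset m : {set pt n} :=
  [set a | [exists k : 'I_m, a == rotm n m k]].

(** For [p] dividing [m], the set of the rotations by multiples of [p] and of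
    the reflections [i |-> k - i] with [k] congruent to [c] modulo [p]. For
    [p = 1] it consists of all rotations and reflections. *)
Definition dihset m p c : {set pt n} :=
  [set a | [exists k : 'I_m, ((p %| k) && (a == rotm n m k))
                          || ((k == c %[mod p]) && (a == refm n m k))]].

Section Fixed.
Variable m : nat.
Hypothesis mn : 0 < m <= n.
Let m0 : 0 < m. Proof. by case/andP: mn. Qed.
Let lemn : m <= n. Proof. by case/andP: mn. Qed.

Lemma rotsetP a : a \in rotset m <-> exists k, a = rotm n m k.
Proof.
rewrite inE; split=> [/existsP[k /eqP->]|[k ->]]; first by exists k.
apply/existsP; exists (Ordinal (ltn_pmod k m0)) => /=.
by apply/eqP/rotm_mod => //; rewrite modn_mod.
Qed.

Lemma dihsetP p c a : p %| m -> a \in dihset m p c <->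
  exists k, (p %| k /\ a = rotm n m k) \/ (k = c %[mod p] /\ a = refm n m k).
Proof.
move=> pm; rewrite inE; split=> [/existsP[k /orP[]/andP[/= pk /eqP->]]|[k H]].
- by exists k; left.
- by exists k; right; split=> //; apply/eqP.
apply/existsP; exists (Ordinal (ltn_pmod k m0)) => /=; apply/orP.
case: H => -[pk ->]; [left|right]; apply/andP; split.
- by rewrite /dvdn modn_dvdm.
- by apply/eqP/rotm_mod => //; rewrite modn_mod.
- by rewrite modn_dvdm // pk.
- by apply/eqP/refm_mod => //; rewrite modn_mod.
Qed.

Lemma dihset1P a :
  a \in dihset m 1 0 <-> exists k, a = rotm n m k \/ a = refm n m k.
Proof.
rewrite dihsetP ?dvd1n //; split=> -[k H]; exists k; last first.
  by case: H => ->; [left|right]; rewrite ?dvd1n ?modn1.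
by case: H => -[_ ->]; [left|right].
Qed.

Lemma rotm_dihset p c k : p %| m -> p %| k -> rotm n m k \in dihset m p c.
Proof. by move=> pm pk; apply/dihsetP => //; exists k; left. Qed.

Lemma refm_dihset p c k : p %| m -> k = c %[mod p] ->
  refm n m k \in dihset m p c.
Proof. by move=> pm pk; apply/dihsetP => //; exists k; right. Qed.

Lemma dihset_congr p c c' : c = c' %[mod p] -> dihset m p c = dihset m p c'.
Proof. by move=> e; apply/setP => a; rewrite !inE e. Qed.

Lemma dihset_mul p c a b : p %| m ->
  a \in dihset m p c -> b \in dihset m p c -> (a * b)%g \in dihset m p c.
Proof.
move=> pm /dihsetP-/(_ pm)[j Hj] /dihsetP-/(_ pm)[k Hk].
case: Hj => -[pj ->]; case: Hk => -[pk ->].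
- by rewrite rotm_rotm // rotm_dihset // dvdn_add.
- rewrite rotm_refm // refm_dihset //; apply/modn_addNl => //.
  by rewrite pk -modnDmr (eqP pj) addn0.
- by rewrite refm_rotm // refm_dihset // -modnDmr (eqP pk) addn0.
- rewrite refm_refm // rotm_dihset //; apply/dvdn_addNl => //.
  by rewrite pj pk.
Qed.

Lemma dihset_inv p c a : p %| m -> a \in dihset m p c ->
  exists2 b, b \in dihset m p c &
    (a * b)%g = rotm n m 0 /\ (b * a)%g = rotm n m 0.
Proof.
move=> pm /dihsetP-/(_ pm)[k [] [pk ->]].
  by exists (rotm n m (m.-1 * k)); rewrite ?rotm_dihset ?dvdn_mull //;
    apply: rotmV.
by exists (refm n m k); rewrite ?refm_dihset // refmV.
Qed.

Lemma dihset_id p c a : p %| m -> a \in dihset m p c ->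
  (rotm n m 0 * a)%g = a /\ (a * rotm n m 0)%g = a.
Proof.
move=> pm /dihsetP-/(_ pm)[k [] [pk ->]].
  by rewrite !rotm_rotm // addn0.
by rewrite rotm_refm // refm_rotm // muln0 addn0.
Qed.

Lemma dihset_sub1 p c : p %| m -> dihset m p c \subset dihset m 1 0.
Proof.
move=> pm; apply/subsetP => a /dihsetP-/(_ pm)[k [] [_ ->]].
  by apply: rotm_dihset; rewrite ?dvd1n.
by apply: refm_dihset; rewrite ?dvd1n ?modn1.
Qed.

Lemma dihset_PORI p c : p %| m -> dihset m p c \subset PORI n.
Proof.
move=> pm; apply/subsetP => a /dihsetP-/(_ pm)[k [] [_ ->]].
  exact: rotm_PORI.
exact: refm_PORI.
Qed.

Lemma rotm_expS k j : (rotm n m k ^+ j.+1)%g = rotm n m (j.+1 * k).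
Proof.
elim: j => [|j IH]; first by rewrite expg1 mul1n.
by rewrite expgS IH rotm_rotm // -mulSn.
Qed.

(** A power of [a] is the identity of the group. *)
Lemma dihset1_pow (X : {set pt n}) a : a \in dihset m 1 0 ->
  {in X &, forall x y, (x * y)%g \in X} -> a \in X -> rotm n m 0 \in X.
Proof.
move=> /dihset1P[k [->|->]] Xm aX; last by rewrite -(refmV k mn) Xm.
have XS j : (rotm n m k ^+ j.+1)%g \in X.
  by elim: j => [|j IH]; rewrite ?expg1 // expgS Xm.
have := XS m.-1; rewrite rotm_expS prednK //.
by rewrite rotm_id // dvdn_mulr.
Qed.

(** A subsemigroup of the dihedral group of order [2 * m] is proper only if it
    contains no reflection or lies in a dihedral subgroup of prime index. *)
Lemma dihset_proper X : X \proper dihset m 1 0 ->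
  {in X &, forall x y, (x * y)%g \in X} ->
  (forall k, refm n m k \notin X) \/
  exists p c, [/\ p \in primes m, X \subset dihset m p c & refm n m c \in X].
Proof.
move=> /properP[sX [y Dy nXy]] Xm.
have [/existsP[c Xc]|] := boolP [exists c : 'I_m, refm n m c \in X]; last first.
  move=> /existsPn H; left=> k; have := H (Ordinal (ltn_pmod k m0)).
  by rewrite (refm_mod lemn (modn_mod k m)).
right.
have X0 : rotm n m 0 \in X by rewrite -(refmV c mn) Xm.
(* The rotations of X are the multiples of the least positive one, which has
   angle d dividing m; properness of X then means d > 1, and p is taken to be a
   prime divisor of d. *)
pose P k := (0 < k) && (rotm n m k \in X).
have exP : exists k, P k by exists m; rewrite /P m0 rotm_id.
case: (ex_minnP exP) => d /andP[d0 Xd] dmin.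
have Xpow j : rotm n m (j * d) \in X.
  by elim: j => [|j IH] //; rewrite mulSn -rotm_rotm // Xm.
have Xdvd k : rotm n m k \in X -> d %| k.
  move=> Xk; have : rotm n m (k %% d) \in X.
    have -> : rotm n m (k %% d) =
              (rotm n m k * rotm n m (m.-1 * (k %/ d) * d))%g.
      rewrite rotm_rotm //; apply: rotm_mod => //; rewrite -mulnA.
      apply/esym/(modn_addNl _ _ _ m0 (dvdnn m)).
      by rewrite addnC -divn_eq.
    exact: Xm.
  move=> Xr; rewrite /dvdn; case: posnP => // r0.
  by have := dmin (k %% d); rewrite /P r0 Xr leqNgt ltn_mod d0 => /(_ isT).
have dm : d %| m by apply: Xdvd; rewrite rotm_id.
have Xref k : refm n m k \in X -> k = c %[mod d].
  move=> Xk; apply/(dvdn_addNl _ _ m0 dm); apply: Xdvd.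
  by rewrite -refm_refm // Xm.
have d1 : 1 < d.
  rewrite ltn_neqAle d0 andbT; apply: contra nXy => /eqP d1.
  have Xrot k : rotm n m k \in X by rewrite -[k]muln1 d1.
  case/dihset1P: Dy => k [->|->] //.
  rewrite -(refm_mod lemn (modn_addN k c m0 (dvdnn m))).
  by rewrite addnCA -refm_rotm // Xm.
have pd := pdiv_dvd d; have pm := dvdn_trans pd dm.
exists (pdiv d), (val c); split=> //.
  by rewrite mem_primes pdiv_prime //= m0.
apply/subsetP => a Xa; have /dihset1P[k ak] := subsetP sX a Xa.
case: ak Xa => -> Xa.
  by apply: rotm_dihset => //; apply: dvdn_trans (Xdvd _ Xa).
by apply: refm_dihset => //; rewrite -(modn_dvdm k pd) (Xref _ Xa) modn_dvdm.
Qed.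

Hypothesis m3 : 3 <= m.
Let m3n : 3 <= m <= n. Proof. by rewrite m3. Qed.

Lemma rotm_dihsetE p c k : p %| m -> (rotm n m k \in dihset m p c) = (p %| k).
Proof.
move=> pm; apply/idP/idP; last exact: rotm_dihset.
move=> /dihsetP-/(_ pm)[j [] [pj e]]; last by case: (rotm_neq_refm m3n e).
have /= e' := rotm_inj mn e.
by rewrite /dvdn -(modn_dvdm k pm) e' modn_dvdm.
Qed.

Lemma refm_dihsetE p c k : p %| m ->
  (refm n m k \in dihset m p c) = (k == c %[mod p]).
Proof.
move=> pm; apply/idP/eqP; last exact: refm_dihset.
move=> /dihsetP-/(_ pm)[j [] [pj e]]; first by case: (rotm_neq_refm m3n (esym e)).
have /= e' := refm_inj mn e.
by rewrite -(modn_dvdm k pm) e' modn_dvdm.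
Qed.

Lemma refm_rotset k : refm n m k \notin rotset m.
Proof. by apply/negP => /rotsetP[j e]; apply: (rotm_neq_refm m3n (esym e)). Qed.

Lemma dihset_subset p q c c' : p \in primes m -> q \in primes m ->
  dihset m p c \subset dihset m q c' -> p = q /\ c = c' %[mod p].
Proof.
rewrite !mem_primes => /and3P[pp _ pm] /and3P[pq _ qm] /subsetP H.
have : rotm n m p \in dihset m q c' by apply: H; rewrite rotm_dihsetE.
rewrite rotm_dihsetE // => qp; have e : p = q.
  by apply/eqP; rewrite eq_sym -(dvdn_prime2 pq pp).
split=> //; have : refm n m c \in dihset m q c' by apply: H; rewrite refm_dihsetE.
by rewrite refm_dihsetE // e => /eqP.
Qed.

Lemma rotm1_dihset p c : p \in primes m -> rotm n m 1 \notin dihset m p c.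
Proof.
rewrite mem_primes => /and3P[pp _ pm]; rewrite rotm_dihsetE // dvdn1.
by case: eqP pp => // ->.
Qed.

End Fixed.
End DihedralSets.

(** * Generated subsemigroups and rank *)

Section Generated.
Variable n : nat.
Implicit Types (a b : pt n) (A T : {set pt n}).

Lemma subsemigroupP T :
  reflect {in T &, forall x y, (x * y)%g \in T} (subsemigroup T).
Proof.
apply: (iffP forall_inP) => [H x y Tx Ty|H x Tx].
  exact: (forall_inP (H x Tx)).
by apply/forall_inP => y; apply: H.
Qed.

Lemma sub_gen A : A \subset gen A.
Proof. by apply/bigcapsP => T /andP[]. Qed.

Lemma gen_subsemigroup A : subsemigroup (gen A).
Proof.
apply/subsemigroupP => x y /bigcapP Gx /bigcapP Gy; apply/bigcapP => T TA.
by case/andP: (TA) => /subsemigroupP Tm _; apply: Tm; [apply: Gx|apply: Gy].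
Qed.

Lemma gen_min A T : subsemigroup T -> A \subset T -> gen A \subset T.
Proof. by move=> Tm AT; apply: bigcap_inf; rewrite Tm. Qed.

Lemma expg_closed T a k : {in T &, forall x y, (x * y)%g \in T} ->
  a \in T -> (a ^+ k.+1)%g \in T.
Proof. by move=> Tm Ta; elim: k => [|k IH]; rewrite ?expg1 // expgS Tm. Qed.

Lemma rotm_closed T m k : 0 < m <= n -> {in T &, forall x y, (x * y)%g \in T} ->
  rotm n m 1 \in T -> rotm n m k \in T.
Proof.
move=> /andP[m0 mn] Tm T1.
have -> : rotm n m k = rotm n m (k + m).-1.+1.
  by apply: rotm_mod => //; rewrite prednK ?modnDr // addn_gt0 m0 orbT.
rewrite -[_.+1]muln1 -(rotm_expS (m := m)) ?m0 //.
exact: expg_closed.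
Qed.

Lemma dihedralE : 0 < n -> dihedral n = dihset n n 1 0.
Proof.
move=> n0; have nn : 0 < n <= n by rewrite n0 leqnn.
apply/eqP; rewrite eqEsubset; apply/andP; split.
  apply: gen_min; last first.
    apply/subsetP => a /set2P[] ->; apply/(dihset1P nn).
      by exists 1; left; apply: cycE.
    by exists n.-1; right; apply: gammaE.
  by apply/subsemigroupP => x y; apply: dihset_mul; rewrite ?dvd1n.
have Gm := subsemigroupP _ (gen_subsemigroup [set cyc n; gamma n]).
have sG := subsetP (sub_gen [set cyc n; gamma n]).
have Gc k : rotm n n k \in dihedral n.
  by apply: rotm_closed => //; rewrite -cycE; apply: sG; rewrite !inE eqxx.
apply/subsetP => a /(dihset1P nn)[k [->|->]] //.
have -> : refm n n k = (gamma n * rotm n n k.+1)%g.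
  rewrite gammaE refm_rotm //; apply: refm_mod => //.
  by rewrite addnS -addSn prednK // modnDl.
by apply: Gm => //; apply: sG; rewrite !inE eqxx orbT.
Qed.

Lemma mem_pdom a (i : 'I_n) : (i \in pdom a) = (av a i < n).
Proof. by rewrite inE av_ord; case: (a i) => [j|]; rewrite ?ltn_ord ?ltnn. Qed.

Lemma mem_pim a (j : 'I_n) : reflect (exists i, av a i = j) (j \in pim a).
Proof.
rewrite inE; apply: (iffP codomP) => -[i e].
  by exists i; rewrite av_ord -e.
have hi : i < n by apply: (@av_dom n a); rewrite e ltn_ord.
exists (Ordinal hi); move: e; rewrite -[i]/(val (Ordinal hi)) av_ord.
case: (a _) => [x /val_inj->//|e].
by have := ltn_ord j; rewrite -e ltnn.
Qed.

Let gval a (i : 'I_n) : 'I_n := odflt i (a i).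

Lemma pim_gval a : pim a = gval a @: pdom a.
Proof.
apply/setP => j; apply/idP/imsetP => [|[i]].
  rewrite inE => /codomP[i e]; exists i; rewrite ?inE /gval -?e //.
rewrite inE /gval; case e : (a i) => [x|] //= _ ->; rewrite inE.
by apply/codomP; exists i.
Qed.

Lemma card_pim_pdom a : a \in PORI n -> #|pim a| = #|pdom a|.
Proof.
move=> aS; rewrite pim_gval card_in_imset // => i j ai aj e; apply/val_inj.
apply: (PORI_inj aS); last by rewrite -mem_pdom.
move: ai aj e; rewrite !inE /gval !av_ord.
by case: (a i) => [x|]; case: (a j) => [y|] //= _ _ ->.
Qed.

Lemma card_pim_mull a b : #|pim (a * b)%g| <= #|pim a|.
Proof.
apply: leq_trans (leq_imset_card (gval b) (pim a)).
apply/subset_leq_card/subsetP => j /mem_pim[i e].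
have lt : av (a * b)%g i < n by rewrite e.
move: e (lt); rewrite av_mul => e /av_dom xn; apply/imsetP.
exists (Ordinal xn); first by apply/mem_pim; exists i.
apply/val_inj => /=; rewrite /gval -e.
move: e; rewrite -[av a i]/(val (Ordinal xn)) av_ord; case: (b _) => // e.
by have := ltn_ord j; rewrite -e ltnn.
Qed.

Lemma card_pim_mulr a b : #|pim (a * b)%g| <= #|pim b|.
Proof.
apply/subset_leq_card/subsetP => j /mem_pim[i e]; apply/mem_pim.
by exists (av a i); rewrite -av_mul.
Qed.

Lemma card_pim_le a : #|pim a| <= n.
Proof. by rewrite -[n in _ <= n]card_ord max_card. Qed.

(** The units are the elements of rank [n]. *)
Lemma card_pim_full a : 0 < n -> a \in PORI n ->
  (#|pim a| == n) = (a \in dihset n n 1 0).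
Proof.
move=> n0 aS; have nn : 0 < n <= n by rewrite n0 leqnn.
rewrite card_pim_pdom //; apply/eqP/idP => [cn|].
  have dT : pdom a = setT.
    by apply/eqP; rewrite eqEcard subsetT cardsT card_ord cn leqnn.
  apply/dihset1P => //; apply: PORI_interval => // i im; last exact: av_out.
  by rewrite -[i]/(val (Ordinal im)) -mem_pdom dT inE.
move=> aD; have dT : pdom a = setT.
  apply/setP => i; rewrite mem_pdom inE.
  by case/dihset1P: aD => // k [->|->];
    rewrite ?av_rotm ?av_refm ?ltn_ord ?ltn_mod.
by rewrite dT cardsT card_ord.
Qed.

(** An element of rank [n - 1] is undefined at exactly one point [i] and misses
    a value [j]. *)
Lemma card_pim_pred a : 0 < n -> a \in PORI n -> #|pim a| = n.-1 ->
  exists i j, [/\ i < n, j < n, forall x, av a x < n <-> x < n /\ x <> i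
                & forall x, av a x <> j].
Proof.
move=> n0 aS cn.
have one (B : {set 'I_n}) : #|B| = n.-1 -> exists i, ~: B = [set i].
  move=> cB; apply/cards1P; have := cardsC B; rewrite cB card_ord => h.
  by apply/eqP; lia.
have [j jE] := one _ cn; rewrite card_pim_pdom // in cn.
have [i iE] := one _ cn.
exists i, j; split=> // [x|x e].
  split=> [ax|[xn xi]].
    have xn := av_dom ax; split=> // xi.
    by have := set11 i; rewrite -iE inE mem_pdom -xi ax.
  have := in_setC (Ordinal xn) (pdom a); rewrite mem_pdom iE inE /=.
  case: eqP => [e|_ /esym/negbFE//]; by case: xi; rewrite -e.
have := set11 j; rewrite -jE inE => /negP[]; apply/mem_pim; by exists x.
Qed.

(** * Generation by the units and the elements of rank [n - 1] *)

(** The partial identities moved at one point: [upshift j] sends [j] to [j + 1]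
    and is undefined at [j + 1], and [downshift j] is its inverse. *)
Definition upshift j : pt n :=
  of_fun n (fun i => if i == j then j.+1 else if i == j.+1 then n else i).
Definition downshift j : pt n :=
  of_fun n (fun i => if i == j.+1 then j else if i == j then n else i).

Lemma av_upshift j i : j.+1 < n -> i <= n ->
  av (upshift j) i = if i == j then j.+1 else if i == j.+1 then n else i.
Proof.
move=> jn; rewrite leq_eqVlt => /orP[/eqP->|h].
  by rewrite av_out //; do !case: ifP => ?; lia.
by rewrite av_of_fun //; do !case: ifP => ?; lia.
Qed.

Lemma av_downshift j i : j.+1 < n -> i <= n ->
  av (downshift j) i = if i == j.+1 then j else if i == j then n else i.
Proof.
move=> jn; rewrite leq_eqVlt => /orP[/eqP->|h].
  by rewrite av_out //; do !case: ifP => ?; lia.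
by rewrite av_of_fun //; do !case: ifP => ?; lia.
Qed.

Lemma upshift_PORI j : j.+1 < n -> upshift j \in PORI n.
Proof.
move=> jn; apply/PORIP; split=> [x y e lt|].
  have xn := av_dom lt.
  have yn : y < n by apply: (@av_dom n (upshift j)); rewrite -e.
  move: e lt; rewrite !av_upshift //; try lia.
  by do !case: ifP => ?; lia.
left=> x y z hx hy hz; have := av_dom hx; have := av_dom hy; have := av_dom hz.
move=> zn yn xn; move: hx hy hz; rewrite !av_upshift //; try lia.
by rewrite /cyc3; do !case: ifP => ?; lia.
Qed.

Lemma downshift_PORI j : j.+1 < n -> downshift j \in PORI n.
Proof.
move=> jn; apply/PORIP; split=> [x y e lt|].
  have xn := av_dom lt.
  have yn : y < n by apply: (@av_dom n (downshift j)); rewrite -e.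
  move: e lt; rewrite !av_downshift //; try lia.
  by do !case: ifP => ?; lia.
left=> x y z hx hy hz; have := av_dom hx; have := av_dom hy; have := av_dom hz.
move=> zn yn xn; move: hx hy hz; rewrite !av_downshift //; try lia.
by rewrite /cyc3; do !case: ifP => ?; lia.
Qed.

Lemma card_pdom_pred a (i : 'I_n) :
  (forall x : 'I_n, av a x < n <-> x != i) -> #|pdom a| = n.-1.
Proof.
move=> H; have -> : pdom a = [set~ i].
  by apply/setP => x; rewrite mem_pdom !inE; apply/idP/idP => /H.
by rewrite cardsC1 card_ord.
Qed.

Lemma card_pim_upshift j : j.+1 < n -> #|pim (upshift j)| = n.-1.
Proof.
move=> jn; rewrite card_pim_pdom ?upshift_PORI //.
apply: (@card_pdom_pred _ (Ordinal jn)) => x; have xn := ltn_ord x.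
rewrite av_upshift //; last exact: ltnW.
rewrite -val_eqE /=; do !case: ifP => ?; lia.
Qed.

Lemma card_pim_downshift j : j.+1 < n -> #|pim (downshift j)| = n.-1.
Proof.
move=> jn; rewrite card_pim_pdom ?downshift_PORI //.
apply: (@card_pdom_pred _ (Ordinal (ltnW jn))) => x; have xn := ltn_ord x.
rewrite av_downshift //; last exact: ltnW.
rewrite -val_eqE /=; do !case: ifP => ?; lia.
Qed.

(** A down-closed domain is an initial interval. *)
Lemma down_closed_interval (P : pred nat) : (forall j, P j.+1 -> P j) ->
  ~~ P n -> exists2 k, k <= n & forall i, P i = (i < k).
Proof.
move=> Pd Pn; have exP : exists k, ~~ P k by exists n.
case: (ex_minnP exP) => k nPk kmin; exists k; first exact: kmin.
move=> i; apply/idP/idP; last by apply: contraLR => /kmin; rewrite -leqNgt.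
apply: contraLR; rewrite -leqNgt => ki; rewrite -(subnKC ki).
by elim: (i - k) => [|d IH]; rewrite ?addn0 // addnS; apply: contra (Pd _) IH.
Qed.

(** In this section [T] is a subsemigroup containing the units and the elements
    of rank [n - 1]. *)
Section Generation.
Hypothesis n2 : 1 < n.
Variable T : {set pt n}.
Hypothesis Tmul : {in T &, forall x y, (x * y)%g \in T}.
Hypothesis TD : dihset n n 1 0 \subset T.
Hypothesis TJ : forall a, a \in PORI n -> #|pim a| = n.-1 -> a \in T.

Let nn : 0 < n <= n. Proof. by rewrite leqnn andbT; lia. Qed.

Let TDn a : a \in dihset n n 1 0 -> a \in T. Proof. exact: (subsetP TD). Qed.

(** The rotation of order [k] is obtained from that of order [k + 1]: move the
    last point [k - 1] to [k] first. *)
Lemma gen_rotm k t : 0 < k <= n -> rotm n k t \in T.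
Proof.
move=> kn; apply: rotm_closed => //; case/andP: kn.
elim: {k t}(n - k) {-2}k (leqnn (n - k)) => [|d IH] k dk k0 kn.
  have -> : k = n by lia.
  by apply: TDn; apply/dihset1P => //; exists 1; left.
have [->|kn'] := eqVneq k n.
  by apply: TDn; apply/dihset1P => //; exists 1; left.
case: k k0 kn kn' dk => // k _ kn kn' dk; have k1n : k.+1 < n by lia.
have -> : rotm n k.+1 1 = (upshift k * rotm n k.+2 1)%g.
  apply: pt_eq => i hi; rewrite av_mul !av_rotm // av_upshift //; last lia.
  case: (ltngtP i k) => [ik|ik|->].
  - have -> : (i == k.+1) = false by lia.
    by rewrite !ifT ?modn_small //; lia.
  - have -> : (i < k.+1) = false by lia.
    by case: (i =P k.+1) => ?; rewrite ifF //; lia.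
  - by rewrite !ifT // !addn1 !modnn.
apply: Tmul; last by apply: IH; lia.
by apply: TJ; [apply: upshift_PORI|apply: card_pim_upshift].
Qed.

(** The reflections of an interval come from those of the whole circle. *)
Lemma gen_interval a k : k <= n -> a \in PORI n ->
  (forall i, i < k -> av a i < k) -> (forall i, k <= i -> av a i = n) ->
  a \in T.
Proof.
move=> kn aS ak ao; case: (posnP k) => [k0|k0].
  (* The empty map: the image of upshift 0 avoids 0. *)
  have -> : a = (upshift 0 * rotm n 1 0)%g.
    apply: pt_eq => i hi; rewrite ao ?k0 // av_mul av_rotm //; last lia.
    rewrite av_upshift //; last exact: ltnW.
    by case: i hi => [|[|i]] // _; rewrite /= ifF //; lia.
  apply: Tmul; last by apply: gen_rotm; lia.
  by apply: TJ; [apply: upshift_PORI|apply: card_pim_upshift].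
have kk : 0 < k <= n by rewrite k0.
have [t [->|->]] := PORI_interval kn aS ak ao; first exact: gen_rotm.
have -> : refm n k t = (rotm n k 0 * refm n n k.-1 * rotm n k t.+1)%g.
  apply: pt_eq => i hi; rewrite !av_mul (av_refm t i kn) (av_rotm 0 i kn).
  case: (ltnP i k) => ik; last first.
    by rewrite (av_out _ (leqnn n)) av_out.
  rewrite addn0 (modn_small ik) (av_refm k.-1 i (leqnn n)) hi.
  rewrite (@modn_flip n) //; last lia.
  rewrite ifT; last lia.
  rewrite av_rotm // ifT; last lia.
  apply/modn_addNl => //.
  have -> : k.-1 - i + t.+1 + i = t + k by lia.
  by rewrite modnDr.
apply: Tmul; last exact: gen_rotm.
apply: Tmul; first exact: gen_rotm.
by apply: TDn; apply/dihset1P => //; exists k.-1; right.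
Qed.

(** By induction on the sum of the values, the image is pushed down until it is
    an initial interval. *)
Lemma gen_dom_interval a k : k <= n -> a \in PORI n ->
  (forall i, (av a i < n) = (i < k)) -> a \in T.
Proof.
move=> kn; have [N] := ubnP (\sum_(i < n) av a i).
elim: N a => // N IH a aN aS ak.
pose P j := (j < n) && [exists i : 'I_n, av a i == j].
have PP j i : j < n -> av a i = j -> P j.
  move=> jn e; have hi : i < n by apply: (@av_dom n a); rewrite e.
  by rewrite /P jn; apply/existsP; exists (Ordinal hi); apply/eqP.
have [/existsP[j /andP[/andP[j1n /existsP[i0 /eqP e0]] nPj]]|] :=
    boolP [exists j : 'I_n, P j.+1 && ~~ P j].
  have naj i : av a i <> j by move=> e; case/negP: nPj; apply: PP e.
  pose b := (a * downshift j)%g.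
  have bE i : av b i = if av a i == j.+1 then val j else av a i.
    rewrite av_mul av_downshift ?av_le //.
    by case: ifP => // _; rewrite ifF //; apply/eqP/naj.
  have bS : b \in PORI n by apply: PORI_mul => //; apply: downshift_PORI.
  have -> : a = (b * upshift j)%g.
    apply: pt_eq => i hi; rewrite av_mul bE av_upshift //; last first.
      by case: ifP => _; [apply/ltnW/ltn_ord|apply: av_le].
    case: (av a i =P j.+1) => [->|ne]; first by rewrite eqxx.
    by rewrite !ifF //; apply/eqP => //; apply: naj.
  apply: Tmul; last by apply: TJ; [apply: upshift_PORI|apply: card_pim_upshift].
  apply: IH => //; last first.
    by move=> i; rewrite bE -ak; case: eqP => // ->; rewrite j1n ltn_ord.
  suff : \sum_(i < n) av b i < \sum_(i < n) av a i by lia.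
  rewrite (bigD1 i0) //= [X in _ < X](bigD1 i0) //= bE e0 eqxx.
  rewrite -addSn leq_add // leq_sum // => i _; rewrite bE.
  by case: eqP => [->|].
rewrite negb_exists => /forallP Pd.
have [||k' k'n Pk'] := @down_closed_interval P.
- move=> j Pj1; have j1n : j.+1 < n by case/andP: Pj1.
  by have := Pd (Ordinal (ltnW j1n)); rewrite /= Pj1 negbK.
- by rewrite /P ltnn.
have dE : pdom a = [set i : 'I_n | i < k].
  by apply/setP => i; rewrite mem_pdom inE ak.
have iE : pim a = [set i : 'I_n | i < k'].
  apply/setP => i; rewrite [in RHS]inE -Pk'; apply/mem_pim/idP => [[x e]|].
    exact: PP e.
  by case/andP=> _ /existsP[x /eqP e]; exists x.
(* The two intervals have the same number of elements. *)
have kk' : k' <= k.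
  rewrite leqNgt; apply/negP => lt.
  have := card_pim_pdom aS; rewrite dE iE => ce.
  have : [set i : 'I_n | i < k] \proper [set i : 'I_n | i < k'].
    apply/properP; split.
      by apply/subsetP => i; rewrite !inE => h; apply: ltn_trans lt.
    by exists (Ordinal (leq_trans lt k'n)); rewrite inE //= ltnn.
  by move/proper_card; rewrite ce ltnn.
apply: (gen_interval kn aS) => [i ik|i ki].
  apply: leq_trans kk'; rewrite -Pk'; apply: PP (erefl _); by rewrite ak.
have := ak i; have := av_le a i; lia.
Qed.

(** By induction on the sum of the points of the domain, the domain is pushed
    down until it is an initial interval. *)
Lemma gen_PORI : PORI n \subset T.
Proof.
apply/subsetP => a.
have [N] := ubnP (\sum_(i < n) if av a i < n then i : nat else 0).
elim: N a => // N IH a aN aS.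
have [/existsP[j /andP[aj1 naj]]|] :=
    boolP [exists j : 'I_n, (av a j.+1 < n) && ~~ (av a j < n)].
  have j1n := av_dom aj1; have aj : av a j = n by have := av_le a j; lia.
  pose b := (upshift j * a)%g.
  have bE i : i < n ->
      av b i = if i == j then av a j.+1 else if i == j.+1 then n else av a i.
    move=> hi; rewrite av_mul av_upshift //; last exact: ltnW.
    by case: ifP => // _; case: ifP => // _; rewrite av_out.
  have -> : a = (downshift j * b)%g.
    apply: pt_eq => i hi; rewrite av_mul av_downshift //; last exact: ltnW.
    case: (i =P j.+1) => [->|ne1]; first by rewrite bE // eqxx.
    case: (i =P val j) => [->|ne]; first by rewrite aj av_out.
    by rewrite bE // !ifF //; apply/eqP.
  apply: Tmul.
    by apply: TJ; [apply: downshift_PORI|apply: card_pim_downshift].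
  apply: IH; last by apply: PORI_mul => //; apply: upshift_PORI.
  pose j1 := Ordinal j1n; have nj : j1 != j by rewrite -val_eqE /=; lia.
  move: aN; rewrite (bigD1 j) //= (bigD1 j1) //= => aN.
  rewrite (bigD1 j) //= (bigD1 j1) //= !bE // !eqxx aj1.
  have -> : (j.+1 == j) = false by lia.
  rewrite ltnn.
  rewrite (eq_bigr (fun i : 'I_n => if av a i < n then i : nat else 0)).
    by move: aN; rewrite aj ltnn aj1 /=; lia.
  move=> i; rewrite -!val_eqE /= => /andP[/negbTE ij /negbTE ij1].
  by rewrite bE // ij ij1.
rewrite negb_exists => /forallP Pd.
have [||k kn Pk] := @down_closed_interval (fun i => av a i < n).
- move=> j Pj1; have j1n := av_dom Pj1.
  by have := Pd (Ordinal (ltnW j1n)); rewrite /= Pj1 negbK.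
- by rewrite av_out // ltnn.
exact: gen_dom_interval Pk.
Qed.

End Generation.
End Generated.

(** * Maximal subgroups of the group of units *)

Lemma primes_dvd p m : p \in primes m -> p %| m.
Proof. by rewrite mem_primes => /and3P[]. Qed.

(** If an antichain [L] of sets with property [P] covers all sets with
    property [P], then the maximal sets with property [P] are those of [L]. *)
Lemma maxset_antichain (T : finType) (P : pred {set T}) (L : seq {set T}) :
  {in L, forall X : {set T}, P X} ->
  (forall X : {set T}, P X -> exists2 Y, Y \in L & X \subset Y) ->
  {in L &, forall X Y : {set T}, X \subset Y -> X = Y} ->
  forall M : {set T}, maxset P M = (M \in L).
Proof.
move=> LP cover anti M; apply/maxsetP/idP => [[PM Mmax]|LM].
  by have [Y LY MY] := cover M PM; rewrite -(Mmax Y (LP Y LY) MY).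
split=> [|X PX MX]; first exact: LP.
have [Y LY XY] := cover X PX; have e := anti M Y LM LY (subset_trans MX XY).
by apply/eqP; rewrite eqEsubset MX andbT e.
Qed.

Section Units.
Variable n : nat.
Hypothesis n3 : 3 <= n.
Implicit Types (a b d x y : pt n) (T U V M X : {set pt n}).

Notation S := (PORI n).
Notation D := (dihset n n 1 0).

Let n0 : 0 < n. Proof. by lia. Qed.
Let nn : 0 < n <= n. Proof. by rewrite n0 leqnn. Qed.
Let dE := dihedralE n0.

Lemma unit_PORI d : d \in D -> d \in S.
Proof. exact/subsetP/(dihset_PORI nn _ (dvd1n n)). Qed.

Lemma unit_one : 1%g \in D.
Proof. by rewrite -rotm_one rotm_dihset // dvd1n. Qed.

Lemma unit_mul a b : a \in D -> b \in D -> (a * b)%g \in D.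
Proof. exact: (dihset_mul nn (dvd1n n)). Qed.

Lemma unit_inv d : d \in D ->
  exists2 d', d' \in D & (d * d')%g = 1%g /\ (d' * d)%g = 1%g.
Proof. by move=> /(dihset_inv nn (dvd1n n)); rewrite rotm_one. Qed.

Lemma card_unit d : d \in D -> #|pim d| = n.
Proof. by move=> dD; apply/eqP; rewrite card_pim_full // unit_PORI. Qed.

(** The elements of [PORI n] that are not units form an ideal. *)
Lemma unit_mul_factors x y : x \in S -> y \in S ->
  (x * y)%g \in D -> x \in D /\ y \in D.
Proof.
move=> xS yS xyD; rewrite -!card_pim_full // -[X in _ == X](card_unit xyD).
rewrite -[X in _ /\ _ == X](card_unit xyD) !eqn_leq card_pim_mull card_pim_mulr.
by rewrite (card_unit xyD) !card_pim_le.
Qed.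

(** The maximal subgroups of the dihedral group of order [2 * n]: the group of
    rotations, and the dihedral subgroups of prime index, where the residue [c]
    modulo [p] tells which reflections belong to the subgroup. *)
Definition Dmaximals : seq {set pt n} :=
  rotset n n :: [seq dihset n n p c | p <- primes n, c <- iota 0 p].

Lemma DmaximalsP U : U \in Dmaximals <-> U = rotset n n \/
  exists p c, [/\ p \in primes n, c < p & U = dihset n n p c].
Proof.
rewrite in_cons; split.
  case/orP=> [/eqP->|/allpairsPdep[p [c [pn ci ->]]]]; first by left.
  by right; exists p, c; rewrite mem_iota in ci.
case=> [->|[p [c [pn cp ->]]]]; first by rewrite eqxx.
by apply/orP; right; apply/allpairsPdep; exists p, c; rewrite mem_iota.
Qed.

Lemma rotset_sub : rotset n n \subset D.
Proof.
by apply/subsetP => a /(rotsetP nn)[k ->]; apply/(dihset1P nn); exists k; left.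
Qed.

Lemma Dmaximals_sub U : U \in Dmaximals -> U \subset D.
Proof.
move=> /DmaximalsP[->|[p [c [pn _ ->]]]]; first exact: rotset_sub.
by apply: dihset_sub1 => //; apply: primes_dvd.
Qed.

Lemma Dmaximals_mul U : U \in Dmaximals ->
  {in U &, forall x y, (x * y)%g \in U}.
Proof.
move=> /DmaximalsP[->|[p [c [pn _ ->]]]] x y.
  by move=> /(rotsetP nn)[j ->] /(rotsetP nn)[k ->]; apply/(rotsetP nn);
    exists (j + k); rewrite rotm_rotm.
by apply: dihset_mul => //; apply: primes_dvd.
Qed.

Lemma Dmaximals_proper U : U \in Dmaximals -> U \proper D.
Proof.
move=> LU; rewrite properE Dmaximals_sub //=; apply/negP => /subsetP DU.
have DU' x : x \in D -> x \in U := DU x.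
case/DmaximalsP: LU => [E|[p [c [pn _ E]]]]; rewrite E in DU'.
  have := refm_rotset nn n3 0; rewrite DU' //.
  by apply/(dihset1P nn); exists 0; right.
have := rotm1_dihset nn n3 c pn; rewrite DU' //.
by apply/(dihset1P nn); exists 1; left.
Qed.

Lemma Dmaximals_subgroup U : U \in Dmaximals -> subgroup U.
Proof.
move=> LU; apply/and3P; split.
- rewrite -rotm_one; case/DmaximalsP: LU => [->|[p [c [pn _ ->]]]].
    by apply/(rotsetP nn); exists 0.
  by apply: rotm_dihset => //; apply: primes_dvd.
- exact/subsemigroupP/Dmaximals_mul.
apply/forall_inP => x Ux; apply/exists_inP.
suff [y Uy [xy yx]] : exists2 y, y \in U &
    (x * y)%g = rotm n n 0 /\ (y * x)%g = rotm n n 0.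
  by exists y => //; rewrite xy yx rotm_one !eqxx.
case/DmaximalsP: LU Ux => [->|[p [c [pn _ ->]]]].
  move=> /(rotsetP nn)[k ->]; exists (rotm n n (n.-1 * k)); last exact: rotmV.
  by apply/(rotsetP nn); exists (n.-1 * k).
by apply: dihset_inv => //; apply: primes_dvd.
Qed.

(** Subsemigroups suffice here, as every element has finite order. *)
Lemma Dmaximals_cover X : X \proper D ->
  {in X &, forall x y, (x * y)%g \in X} ->
  exists2 U, U \in Dmaximals & X \subset U.
Proof.
move=> XD Xm; have [nX|[p [c [pn XV _]]]] := dihset_proper nn XD Xm.
  exists (rotset n n); first by rewrite inE eqxx.
  apply/subsetP => x Xx.
  have /(dihset1P nn)[k xk] := subsetP (proper_sub XD) x Xx.
  apply/(rotsetP nn); exists k; case: xk => // e.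
  by have := nX k; rewrite -e Xx.
exists (dihset n n p (c %% p)).
  apply/DmaximalsP; right; exists p, (c %% p); split=> //.
  by rewrite ltn_mod prime_gt0 //; move: pn; rewrite mem_primes => /and3P[].
by rewrite (dihset_congr _ _ (modn_mod c p)).
Qed.

Lemma Dmaximals_anti : {in Dmaximals &, forall U V, U \subset V -> U = V}.
Proof.
move=> U V /DmaximalsP[->|[p [c [pn cp ->]]]]
  /DmaximalsP[->|[q [c' [qn cq ->]]]] //.
- move/subsetP/(_ (rotm n n 1)) => H.
  have := rotm1_dihset nn n3 c' qn; rewrite H //.
  by apply/(rotsetP nn); exists 1.
- move/subsetP/(_ (refm n n c)) => H.
  have := refm_rotset nn n3 c; rewrite H //.
  by apply: refm_dihset => //; apply: primes_dvd.
move=> /(dihset_subset nn n3 pn qn)[e ec]; subst q.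
by rewrite !modn_small // in ec; rewrite ec.
Qed.

Lemma Dmaximals_uniq : uniq Dmaximals.
Proof.
rewrite /= ; apply/andP; split.
  apply/negP => /allpairsPdep[p [c [pn _ E]]].
  have := rotm1_dihset nn n3 c pn; rewrite -E => /negP[].
  by apply/(rotsetP nn); exists 1.
apply: allpairs_uniq_dep.
- exact: primes_uniq.
- by move=> p _; apply: iota_uniq.
move=> u w /allpairsPdep[p [c [pn cp ->]]].
case/allpairsPdep=> [q [c' [qn cq ->]]] /= E.
rewrite !mem_iota /= !add0n in cp cq.
have sE : dihset n n p c \subset dihset n n q c' by rewrite E.
have [e ec] := dihset_subset nn n3 pn qn sE.
by subst q; rewrite !modn_small // in ec; rewrite ec.
Qed.

Lemma size_Dmaximals : size Dmaximals = 1 + \sum_(p <- primes n) p.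
Proof.
rewrite /= size_allpairs_dep sumnE big_map; congr _.+1.
by apply: eq_bigr => p _; rewrite size_iota.
Qed.

Lemma maximal_subgroupE U : maximal_subgroup (dihedral n) U = (U \in Dmaximals).
Proof.
rewrite dE; apply: maxset_antichain => [V LV|V|]; last exact: Dmaximals_anti.
  by rewrite Dmaximals_subgroup ?Dmaximals_proper.
move=> /andP[/and3P[_ /subsemigroupP Vm _] VD].
exact: Dmaximals_cover.
Qed.

Lemma in_family_a U x :
  x \in family_a U = (x \in S) && (x \notin D) || (x \in U).
Proof. by rewrite in_setU in_setD dE andbC. Qed.

Lemma family_a_mul U : U \in Dmaximals -> subsemigroup (family_a U).
Proof.
move=> LU; have UD x : x \in U -> x \in D := subsetP (Dmaximals_sub LU) x.
apply/subsemigroupP => x y; rewrite !in_family_a => Fx Fy.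
have xS : x \in S by case/orP: Fx => [/andP[]//|/UD/unit_PORI].
have yS : y \in S by case/orP: Fy => [/andP[]//|/UD/unit_PORI].
rewrite PORI_mul //=; case: (boolP (_ \in D)) => // xyD /=.
have [xD yD] := unit_mul_factors xS yS xyD; move: Fx Fy; rewrite xD yD !andbF /=.
exact: Dmaximals_mul.
Qed.

Lemma family_a_proper U : U \in Dmaximals -> family_a U \proper S.
Proof.
move=> LU; have /properP[UD [d dD dU]] := Dmaximals_proper LU.
apply/properP; split.
  apply/subsetP => x; rewrite in_family_a => /orP[/andP[]//|Ux].
  exact/unit_PORI/(subsetP UD).
by exists d; rewrite ?unit_PORI // in_family_a dD andbF.
Qed.

Lemma family_a_anti U V : U \in Dmaximals -> V \in Dmaximals ->
  family_a U \subset family_a V -> U = V.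
Proof.
move=> LU LV /subsetP H; apply: Dmaximals_anti => //; apply/subsetP => x Ux.
have := H x; rewrite !in_family_a Ux orbT => /(_ isT).
by rewrite (subsetP (Dmaximals_sub LU) x Ux) andbF.
Qed.

(** The case of a subsemigroup that misses a unit. *)
Lemma family_a_cover T : subsemigroup T -> T \subset S -> ~~ (D \subset T) ->
  exists2 U, U \in Dmaximals & T \subset family_a U.
Proof.
move=> /subsemigroupP Tm TS nDT.
have [||U LU XU] := @Dmaximals_cover (T :&: D).
- rewrite properE subsetIr /=; apply: contra nDT => DT.
  exact: subset_trans DT (subsetIl _ _).
- by move=> x y /setIP[Tx Dx] /setIP[Ty Dy]; rewrite in_setI Tm // unit_mul.
exists U => //; apply/subsetP => x Tx; rewrite in_family_a (subsetP TS x Tx) /=.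
case: (boolP (x \in D)) => // Dx /=; apply: (subsetP XU).
by rewrite in_setI Tx.
Qed.
End Units.

(** * Elements of rank [n - 1] *)

Section RankPred.
Variable n : nat.
Hypothesis n3 : 3 <= n.
Implicit Types (a b d h x y : pt n) (T U V M X : {set pt n}).

Notation S := (PORI n).
Notation D := (dihset n n 1 0).
Notation m := (n.-1).
(* H is the group of the elements with domain and image the first n - 1
   points, e is its identity, and t is tau n. *)
Notation H := (dihset n n.-1 1 0).
Notation e := (rotm n n.-1 0).
Notation t := (refm n n.-1 n.-2).

Let n0 : 0 < n. Proof. by lia. Qed.
Let nn : 0 < n <= n. Proof. by rewrite n0 leqnn. Qed.
Let mn : 0 < m <= n. Proof. by lia. Qed.
Let lemn : m <= n. Proof. by lia. Qed.

Lemma av_interval_group h i : h \in H ->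
  (i < m -> av h i < m) /\ (m <= i -> av h i = n).
Proof.
move=> /(dihset1P mn)[k [->|->]]; rewrite ?av_rotm ?av_refm //.
  by case: ltnP => // im; rewrite ltn_mod; lia.
by case: ltnP => // im; rewrite ltn_mod; lia.
Qed.

Lemma interval_group_surj h u : h \in H -> u < m ->
  exists2 i, i < m & av h i = u.
Proof.
move=> hH um; have [g gH [_ gh]] := dihset_inv mn (dvd1n m) hH.
exists (av g u); first by have [] := av_interval_group u gH; auto.
by rewrite -av_mul gh rotm0_av.
Qed.

Lemma interval_group_PORI h : h \in H -> h \in S.
Proof. exact/subsetP/(dihset_PORI mn _ (dvd1n m)). Qed.

Lemma card_interval_group h : h \in H -> #|pim h| = n.-1.
Proof.
move=> hH; rewrite card_pim_pdom ?interval_group_PORI //.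
have lt : m < n by lia.
apply: (card_pdom_pred (i := Ordinal lt)) => x; have xn := ltn_ord x.
rewrite -val_eqE /=; have [h1 h2] := av_interval_group x hH.
by case: (ltnP x m) h1 h2 => [|] c h1 h2; [have := h1 isT|have := h2 isT]; lia.
Qed.

(** A unit preserving the first [n - 1] points is the identity or the
    reflection fixing the last point. *)
Lemma unit_stab_interval d : d \in D -> (forall i, i < m -> av d i < m) ->
  (e * d)%g = e \/ (e * d)%g = t.
Proof.
move=> dD dm; have /(dihset1P nn)[k dk] := dD.
have kn : k %% n < n by rewrite ltn_mod.
case: dk => dk; [left|right]; apply: pt_eq => i hi; rewrite av_mul.
  have k0 : k %% n = 0.
    have := dm (n.-2); rewrite dk av_rotm // ifT; last lia.
    rewrite -modnDmr modn_shift //; try lia.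
    case: (posnP (k %% n)) => // kp.
    have := dm (m - k %% n); rewrite dk av_rotm // ifT; last lia.
    rewrite -modnDmr modn_shift //; try lia.
    by do !case: ifP => ?; lia.
  rewrite av_rotm // !addn0; case: ltnP => im; last by rewrite av_out.
  by rewrite modn_small // dk (rotm_id (leqnn n)) ?rotm0_av // /dvdn k0.
have k2 : k %% n = n.-2.
  case: (ltngtP (k %% n) n.-2) => // kk; last first.
    have := dm 0; rewrite dk av_refm // n0 muln0 addn0; lia.
  have := dm (k %% n).+1; rewrite dk av_refm // ifT; last lia.
  rewrite -modnDml modn_flip //; try lia.
  by case: ifP => ?; lia.
rewrite av_rotm // addn0 av_refm //; case: ltnP => im; last by rewrite av_out.
rewrite modn_small // dk av_refm // hi -modnDml k2 !modn_flip //; try lia.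
by do !case: ifP => ?; lia.
Qed.

Lemma card_pim_mulD d1 d2 x : d1 \in D -> d2 \in D ->
  #|pim (d1 * x * d2)%g| = #|pim x|.
Proof.
move=> d1D d2D; have [b1 _ [_ b1d]] := unit_inv n3 d1D.
have [b2 _ [d2b _]] := unit_inv n3 d2D.
apply/eqP; rewrite eqn_leq (leq_trans (card_pim_mull _ _)) ?card_pim_mulr //=.
have {1}-> : x = (b1 * (d1 * x * d2) * b2)%g.
  by rewrite -!mulgA d2b mulg1 mulgA b1d mul1g.
exact: leq_trans (card_pim_mull _ _) (card_pim_mulr _ _).
Qed.

(** The unit [d1] moves the last point to the point where [x] is undefined, and
    [d2] moves the missing value of [x] to the last point. *)
Lemma rank_pred_transport x : x \in S -> #|pim x| = n.-1 ->
  exists d1 d2, [/\ d1 \in D, d2 \in D & (d1 * x * d2)%g \in H].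
Proof.
move=> xS cx; have [i [j [hi hj xi xj]]] := card_pim_pred n0 xS cx.
pose d1 := rotm n n i.+1; pose d2 := rotm n n (m - j).
have d1D : d1 \in D by apply: rotm_dihset; rewrite ?dvd1n.
have d2D : d2 \in D by apply: rotm_dihset; rewrite ?dvd1n.
exists d1, d2; split=> //; apply/(dihset1P mn); apply: PORI_interval => //.
- by apply: PORI_mul; [apply: PORI_mul|] => //; apply: unit_PORI.
- move=> u um; rewrite !av_mul /d1 av_rotm // ifT; last lia.
  set v := _ %% _; have vn : v < n by rewrite ltn_mod.
  have vi : v <> i.
    move=> e; have : (u.+1 + i) %% n = i by rewrite -[RHS]e addSnnS.
    by rewrite modn_shift //; [case: ifP => ?; lia|lia].
  have xv : av x v < n by apply/xi.
  rewrite /d2 av_rotm // xv modn_shift //; last lia.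
  by have := xj v; case: ifP => ?; lia.
move=> u um; rewrite !av_mul; case: (ltnP u n) => un; last by rewrite !av_out.
have -> : u = m by lia.
rewrite /d1 av_rotm // ifT; last lia.
have -> : (m + i.+1) %% n = i.
  by rewrite -addSnnS prednK // addnC modnDr modn_small.
have -> : av x i = n.
  apply/eqP; rewrite eqn_leq av_le leqNgt; apply/negP => lt.
  by have /xi[_] := lt.
by rewrite av_out.
Qed.

Lemma rank_pred_factor x : x \in S -> #|pim x| = n.-1 ->
  exists d1 d2 h, [/\ d1 \in D, d2 \in D, h \in H & x = (d1 * h * d2)%g].
Proof.
move=> xS cx; have [d1 [d2 [d1D d2D xH]]] := rank_pred_transport xS cx.
have [b1 b1D [_ b1d]] := unit_inv n3 d1D.
have [b2 b2D [d2b _]] := unit_inv n3 d2D.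
exists b1, b2, (d1 * x * d2)%g; split=> //.
by rewrite -!mulgA d2b mulg1 mulgA b1d mul1g.
Qed.

Lemma interval_group_id h : h \in H -> (e * h)%g = h /\ (h * e)%g = h.
Proof. exact: (dihset_id mn (dvd1n m)). Qed.

(** If the product [h1 * d * h2] does not lose rank, then [d] preserves the
    first [n - 1] points, so it acts on them as the identity or as [t]. *)
Lemma sandwich h1 h2 d : h1 \in H -> h2 \in H -> d \in D ->
  #|pim (h1 * d * h2)%g| = n.-1 ->
  (h1 * d * h2)%g = (h1 * h2)%g \/ (h1 * d * h2)%g = (h1 * t * h2)%g.
Proof.
move=> h1H h2H dD c.
have dm i : i < m -> av d i < m.
  move=> im; have [u um <-] := interval_group_surj h1H im.
  have zS : (h1 * d * h2)%g \in S.
    apply: PORI_mul; last exact: interval_group_PORI.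
    by apply: PORI_mul; [apply: interval_group_PORI|apply: unit_PORI].
  have [w [_ [wn _ zw _]]] := card_pim_pred n0 zS c.
  have wm : w = m.
    have [_ h] := av_interval_group m h1H; apply/eqP/negPn/negP => /eqP nw.
    have : av (h1 * d * h2)%g m < n by apply/zw; lia.
    by rewrite !av_mul h // !av_out // ltnn.
  have : av (h1 * d * h2)%g u < n by apply/zw; lia.
  rewrite !av_mul => lt; rewrite ltnNge; apply/negP => ge.
  by have [_ h] := av_interval_group (av d (av h1 u)) h2H; rewrite h ?ltnn in lt.
have [_ he] := interval_group_id h1H.
have -> : (h1 * d * h2)%g = (h1 * (e * d) * h2)%g by rewrite mulgA he.
by case: (unit_stab_interval dD dm) => ->; [left; rewrite he|right].
Qed.

Lemma av_tau i : i < m -> av t i = m.-1 - i.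
Proof.
by move=> im; rewrite av_refm // im modn_flip //; [rewrite ifT //|]; lia.
Qed.

(** The reflection fixing the last point. *)
Lemma av_flip i : i < n ->
  av (refm n n n.-2) i = if i == m then m else m.-1 - i.
Proof.
move=> hi; rewrite av_refm // hi modn_flip //; last by lia.
by do !case: ifP => ?; lia.
Qed.

Lemma tau_factor : t = (refm n n n.-2 * e)%g.
Proof.
apply: pt_eq => i hi; rewrite av_mul av_flip //.
case: eqP => im; first by rewrite av_refm // av_rotm // ifF ?ifF //; lia.
by rewrite av_tau ?rotm0_av //; lia.
Qed.

Lemma interval_group_one : e \in H.
Proof. by rewrite rotm_dihset // ?dvd1n. Qed.
Lemma interval_group_tau : t \in H.
Proof. by rewrite refm_dihset // ?dvd1n ?modn1. Qed.

(** If multiplication by units on both sides keeps an element of [H] in [H],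
    then these units act as [e] or [t]. *)
Lemma unit_conj_interval h d1 d2 : h \in H -> d1 \in D -> d2 \in D ->
  (d1 * h * d2)%g \in H ->
  exists t1 t2, [/\ t1 \in [:: e; t], t2 \in [:: e; t] &
     (d1 * h * d2)%g = (t1 * h * t2)%g].
Proof.
move=> hH d1D d2D zH; have [ez ze] := interval_group_id zH.
have [eh he] := interval_group_id hH.
have d1m i : i < m -> av d1 i < m.
  move=> im; have [h1 _] := av_interval_group i zH.
  have := h1 im; rewrite !av_mul => lt.
  rewrite ltnNge; apply/negP => ge.
  have [_ h2] := av_interval_group (av d1 i) hH.
  by move: lt; rewrite h2 // av_out //; lia.
have d2m i : i < m -> av d2 i < m.
  move=> im; have [u um uE] := interval_group_surj hH im.
  have [w wm wE] : exists2 w, w < m & av d1 w = u.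
    have [E|E] := unit_stab_interval d1D d1m.
      exists u => //.
      by rewrite -[u in av d1 u](rotm0_av lemn um) -av_mul E rotm0_av.
    have [w wm wE] := interval_group_surj interval_group_tau um; exists w => //.
    by rewrite -[w in av d1 w](rotm0_av lemn wm) -av_mul E.
  by have [h1 _] := av_interval_group w zH; have := h1 wm; rewrite !av_mul wE uE.
have E1 := unit_stab_interval d1D d1m; have E2 := unit_stab_interval d2D d2m.
exists (e * d1)%g, (e * d2)%g; split.
- by case: E1 => ->; rewrite !inE eqxx ?orbT.
- by case: E2 => ->; rewrite !inE eqxx ?orbT.
have -> : (e * d1 * h * (e * d2))%g = (e * (d1 * (h * e) * d2))%g.
  by rewrite !mulgA.
by rewrite he ez.
Qed.

(** The subsemigroup of [PORI n] containing all elements of rank other than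
    [n - 1], which meets [H] in the dihedral subgroup of index [p] that
    contains [t]. *)
Definition Bset p : {set pt n} :=
  [set x in S | (#|pim x| == n.-1) ==>
     [exists d1 in D, exists d2 in D,
        (d1 * x * d2)%g \in dihset n n.-1 p n.-2]].

Lemma BsetP p x : x \in Bset p <-> x \in S /\
  (#|pim x| = n.-1 -> exists d1 d2,
     [/\ d1 \in D, d2 \in D & (d1 * x * d2)%g \in dihset n n.-1 p n.-2]).
Proof.
rewrite in_set; split.
  move=> /andP[xS /implyP xB]; split=> // /eqP /xB /exists_inP[d1 d1D].
  by move=> /exists_inP[d2 d2D h]; exists d1, d2.
move=> [xS xB]; rewrite xS; apply/implyP => /eqP /xB [d1 [d2 [d1D d2D h]]].
by apply/exists_inP; exists d1 => //; apply/exists_inP; exists d2.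
Qed.

Lemma card_unit_neq d : d \in D -> #|pim d| <> n.-1.
Proof. by move=> /(card_unit n3)->; lia. Qed.

Lemma unit_Bset p d : d \in D -> d \in Bset p.
Proof.
by move=> dD; apply/BsetP; split; [apply: unit_PORI|move/(card_unit_neq dD)].
Qed.

Section Prime.
Variable p : nat.
Hypothesis pm : p %| m.
Notation V := (dihset n n.-1 p n.-2).

Lemma dihset_tau : t \in V. Proof. exact: refm_dihset. Qed.
Lemma dihset_one : e \in V. Proof. exact: rotm_dihset. Qed.
Lemma dihset_interval_group h : h \in V -> h \in H.
Proof. exact/subsetP/dihset_sub1. Qed.
Lemma dihset_closed a b : a \in V -> b \in V -> (a * b)%g \in V.
Proof. exact: dihset_mul. Qed.

Lemma Bset_H h : h \in Bset p -> h \in H -> h \in V.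
Proof.
move=> /BsetP[_ /[swap] hH]; case=> [|d1 [d2 [d1D d2D zV]]].
  exact: card_interval_group.
set z := (d1 * h * d2)%g in zV.
have [b1 b1D [_ b1d]] := unit_inv n3 d1D.
have [b2 b2D [d2b _]] := unit_inv n3 d2D.
have hE : h = (b1 * z * b2)%g by rewrite -!mulgA d2b mulg1 mulgA b1d mul1g.
rewrite hE in hH *.
have zH := dihset_interval_group zV.
have [t1 [t2 [t1E t2E ->]]] := unit_conj_interval zH b1D b2D hH.
have tV x : x \in [:: e; t] -> x \in V.
  rewrite 2!in_cons orbF => /orP[] /eqP->.
    exact: dihset_one.
  exact: dihset_tau.
by apply: dihset_closed; [apply: dihset_closed => //|]; apply: tV.
Qed.

Lemma dihset_Bset h : h \in V -> h \in Bset p.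
Proof.
move=> hV; apply/BsetP; split.
  exact/interval_group_PORI/dihset_interval_group.
by move=> _; exists 1%g, 1%g; rewrite mul1g mulg1 !unit_one.
Qed.

Lemma Bset_subsemigroup : subsemigroup (Bset p).
Proof.
apply/subsemigroupP => x y /BsetP[xS xB] /BsetP[yS yB]; apply/BsetP.
split=> [|cxy]; first exact: PORI_mul.
have := card_pim_mull x y; have := card_pim_mulr x y; rewrite cxy => cy cx.
have nx := card_pim_le x; have ny := card_pim_le y.
have [xD|xD] := boolP (x \in D).
  have cyn : #|pim y| = n.-1.
    by have := card_pim_mulD y xD (unit_one n3); rewrite mulg1 => <-.
  have [d1 [d2 [d1D d2D h]]] := yB cyn; have [x' x'D [_ x'x]] := unit_inv n3 xD.
  exists (d1 * x')%g, d2; split=> //; first exact: unit_mul.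
  by rewrite -(mulgA d1) (mulgA x') x'x mul1g.
have [yD|yD] := boolP (y \in D).
  have cxn : #|pim x| = n.-1.
    by have := card_pim_mulD x (unit_one n3) yD; rewrite mul1g => <-.
  have [d1 [d2 [d1D d2D h]]] := xB cxn; have [y' y'D [yy' _]] := unit_inv n3 yD.
  exists d1, (y' * d2)%g; split=> //; first exact: unit_mul.
  by rewrite !mulgA -(mulgA _ y) yy' mulg1.
rewrite -card_pim_full // in xD; rewrite -card_pim_full // in yD.
have cxn : #|pim x| = n.-1 by lia.
have cyn : #|pim y| = n.-1 by lia.
have [d1 [d2 [d1D d2D h]]] := xB cxn; have [d3 [d4 [d3D d4D h']]] := yB cyn.
have [b2 b2D [d2b _]] := unit_inv n3 d2D; have [b3 b3D [_ b3d]] := unit_inv n3 d3D.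
have zE : (d1 * (x * y) * d4 = (d1 * x * d2) * (b2 * b3) * (d3 * y * d4))%g.
  by rewrite !mulgA -(mulgA _ d2) d2b mulg1 -(mulgA _ b3) b3d mulg1.
exists d1, d4; split=> //; rewrite zE.
have [hH hH'] := (dihset_interval_group h, dihset_interval_group h').
have [||->|->] := @sandwich _ _ (b2 * b3)%g hH hH'.
- exact: unit_mul.
- by rewrite -zE card_pim_mulD.
- exact: dihset_closed.
- by apply: dihset_closed => //; apply: dihset_closed => //; apply: dihset_tau.
Qed.

(** The powers of [zeta n ^+ p], and their products with [tau n], exhaust the
    dihedral subgroup of [H] that defines [Bset p]. *)
Lemma family_bE : family_b n p = Bset p.
Proof.
have zE : (zeta n ^+ p)%g = rotm n m p.
  rewrite zetaE; case: p pm => [|q] qm; last by rewrite (rotm_expS mn) muln1.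
  by move: qm; rewrite dvd0n => /eqP; lia.
apply/eqP; rewrite eqEsubset; apply/andP; split.
  apply: gen_min; first exact: Bset_subsemigroup.
  apply/subsetP => x /setUP[/setDP[xS xJ]|/set2P[]->].
  - by apply/BsetP; split=> // /eqP cx; move: xJ; rewrite inE cx.
  - by apply: dihset_Bset; rewrite zE rotm_dihset.
  - by rewrite tauE; apply: dihset_Bset; apply: dihset_tau.
pose A := (S :\: Jn1 n) :|: [set (zeta n ^+ p)%g; tau n].
have Gm := subsemigroupP _ (gen_subsemigroup A).
have sG := subsetP (sub_gen A); rewrite -/(family_b n p) in sG Gm.
have GJ x : x \in S -> #|pim x| <> n.-1 -> x \in family_b n p.
  move=> xS cx; apply: sG; rewrite in_setU in_setD xS inE andbT.
  by apply/orP; left; apply/eqP.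
have GD d : d \in D -> d \in family_b n p.
  by move=> dD; apply: GJ; [apply: unit_PORI|apply: card_unit_neq].
have Gr k : p %| k -> rotm n m k \in family_b n p.
  move=> pk; have -> : rotm n m k = rotm n m (k + m).
    by apply: rotm_mod; rewrite ?modnDr.
  have /dvdnP[q kq] : p %| k + m by rewrite dvdn_add.
  rewrite kq; case: q kq => [|q] kq; first by lia.
  rewrite -(rotm_expS mn) -zE; apply: expg_closed => //.
  by apply: sG; rewrite in_setU set21 orbT.
have Gt : t \in family_b n p.
  by apply: sG; rewrite -tauE in_setU set22 orbT.
have GV h : h \in V -> h \in family_b n p.
  move=> /(dihsetP mn _ _ pm)[k [] [pk ->]]; first exact: Gr.
  have -> : refm n m k = (t * rotm n m (k + m.-1 * n.-2))%g.
    rewrite refm_rotm //; apply: refm_mod => //; rewrite addnCA.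
    by apply/esym/modn_addN => //; case/andP: mn.
  by apply: Gm => //; apply: Gr; apply/dvdn_addNl => //; case/andP: mn.
apply/subsetP => x /BsetP[xS xB].
have [cx|cx] := eqVneq #|pim x| n.-1; last first.
  by apply: GJ => //; apply/eqP.
have [d1 [d2 [d1D d2D h]]] := xB cx.
have [b1 b1D [_ b1d]] := unit_inv n3 d1D.
have [b2 b2D [d2b _]] := unit_inv n3 d2D.
have -> : x = (b1 * (d1 * x * d2) * b2)%g.
  by rewrite -!mulgA d2b mulg1 mulgA b1d mul1g.
by apply: (Gm); [apply: (Gm); [apply: GD|apply: GV]|apply: GD].
Qed.

End Prime.
End RankPred.

(** * Maximal subsemigroups *)

Section Classification.
Variable n : nat.
Hypothesis n3 : 3 <= n.
Implicit Types (a b d h x y : pt n) (T U V M X : {set pt n}).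

Notation S := (PORI n).
Notation D := (dihset n n 1 0).
Notation m := (n.-1).
Notation H := (dihset n n.-1 1 0).
Notation e := (rotm n n.-1 0).
Notation t := (refm n n.-1 n.-2).

Let n0 : 0 < n. Proof. by lia. Qed.
Let nn : 0 < n <= n. Proof. by rewrite n0 leqnn. Qed.
Let mn : 0 < m <= n. Proof. by lia. Qed.

(** In this section [T] is a subsemigroup containing all units. *)
Section Over.
Variable T : {set pt n}.
Hypothesis Tm : {in T &, forall x y, (x * y)%g \in T}.
Hypothesis DT : D \subset T.

Let TD d : d \in D -> d \in T. Proof. exact: (subsetP DT). Qed.

(** A power of [h] is [e], and [t] is the product of a unit and [e]. *)
Lemma over_units_tau h : h \in T -> h \in H -> e \in T /\ t \in T.
Proof.
move=> hT hH; have eT : e \in T.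
  have : e \in T :&: H.
    apply: (dihset1_pow mn hH); last by rewrite in_setI hT.
    by move=> x y /setIP[xT xH] /setIP[yT yH]; rewrite in_setI Tm //
      (dihset_mul mn (dvd1n m)).
  by case/setIP.
split=> //; rewrite (tau_factor n3) Tm // TD // refm_dihset // ?dvd1n ?modn1 //.
Qed.

Lemma over_units_full : H \subset T -> S \subset T.
Proof.
move=> HT; apply: gen_PORI => //; first lia.
move=> x xS cx; have [d1 [d2 [h [d1D d2D hH ->]]]] := rank_pred_factor n3 xS cx.
by apply: Tm; [apply: Tm; [apply: TD|apply: (subsetP HT)]|apply: TD].
Qed.

Lemma over_units_transport x : x \in S -> #|pim x| = n.-1 -> x \in T ->
  exists d1 d2, [/\ d1 \in D, d2 \in D & (d1 * x * d2)%g \in T :&: H].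
Proof.
move=> xS cx xT; have [d1 [d2 [d1D d2D zH]]] := rank_pred_transport n3 xS cx.
by exists d1, d2; split=> //; rewrite in_setI zH andbT; apply: Tm;
  [apply: Tm => //; apply: TD|apply: TD].
Qed.

Lemma Bset_cover : 3 < n -> T \proper S ->
  exists2 p, p \in primes m & T \subset Bset n p.
Proof.
move=> n4 /properP[TS [y yS yT]].
have m3 : 2 < m by lia.
have [X0|[h]] := set_0Vmem (T :&: H).
  (* No element of T has rank n - 1, so any prime divisor of n - 1 will do. *)
  exists (pdiv m).
    by rewrite mem_primes pdiv_prime ?pdiv_dvd ?andbT //=; lia.
  apply/subsetP => x xT; have xS := subsetP TS x xT.
  apply/BsetP; split=> // cx.
  have [d1 [d2 [_ _]]] := over_units_transport xS cx xT.
  by rewrite X0 inE.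
move=> /setIP[hT hH]; have [eT tT] := over_units_tau hT hH.
have XH : T :&: H \proper H.
  rewrite properE subsetIr /=; apply: contra yT => HX.
  apply: (subsetP (over_units_full _)) => //.
  exact: subset_trans HX (subsetIl _ _).
have Xm : {in T :&: H &, forall x z, (x * z)%g \in T :&: H}.
  by move=> x z /setIP[xT xH] /setIP[zT zH]; rewrite in_setI Tm //
    (dihset_mul mn (dvd1n m)).
have [nX|[p [c [pm XV _]]]] := dihset_proper mn XH Xm.
  by have := nX n.-2; rewrite in_setI tT (interval_group_tau n3).
exists p => //; have pdm := primes_dvd pm.
(* The subgroup of index p containing t is unique. *)
have cE : dihset n m p c = dihset n m p n.-2.
  apply: dihset_congr; have : t \in dihset n m p c.
    by apply: (subsetP XV); rewrite in_setI tT (interval_group_tau n3).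
  by rewrite (refm_dihsetE mn m3) // => /eqP.
apply/subsetP => x xT; have xS := subsetP TS x xT.
apply/BsetP; split=> // cx.
have [d1 [d2 [d1D d2D zX]]] := over_units_transport xS cx xT.
by exists d1, d2; split=> //; rewrite -cE; apply: (subsetP XV).
Qed.

(** For [n = 3] the group [H] consists of [e] and [t] only. *)
Lemma rank_pred_cover : n = 3 -> T \proper S -> T \subset S :\: Jn1 n.
Proof.
move=> nE /properP[TS [y yS yT]]; apply/subsetP => x xT.
have xS := subsetP TS x xT.
rewrite in_setD xS andbT inE; apply/eqP => cx.
have [d1 [d2 [_ _ /setIP[zT zH]]]] := over_units_transport xS cx xT.
have [eT tT] := over_units_tau zT zH.
case/negP: yT; apply: (subsetP (over_units_full _)) => //.
have rT k : rotm n m k \in T.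
  have -> : rotm n m k = rotm n m (k %% 2).
    by apply: rotm_mod; [lia|rewrite nE /= modn_mod].
  have : k %% 2 < 2 by rewrite ltn_mod.
  case: (k %% 2) => [|[|//]] _ //.
  have -> : rotm n m 1 = t; last by [].
  by apply: pt_eq => i hi; rewrite av_rotm ?av_refm ?nE //; move: hi; rewrite nE;
    case: i => [|[|[|i]]].
apply/subsetP => h /(dihset1P mn)[k [->|->]] //.
have -> : refm n m k = rotm n m k; last by [].
apply: pt_eq => i hi; rewrite av_rotm ?av_refm ?nE // !mul1n.
by rewrite addnC.
Qed.

End Over.

Lemma Bset_anti p q : 3 < n -> p \in primes m -> q \in primes m ->
  Bset n p \subset Bset n q -> p = q.
Proof.
move=> n4 pm qm /subsetP BB; have m3 : 2 < m by lia.
have pd := primes_dvd pm; have qd := primes_dvd qm.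
suff VV : dihset n m p n.-2 \subset dihset n m q n.-2.
  by have [] := dihset_subset mn m3 pm qm VV.
apply/subsetP => h hV.
apply: (Bset_H n3 qd); last exact: dihset_interval_group hV.
by apply: BB; apply: dihset_Bset.
Qed.

(** An antichain [L] of proper subsemigroups containing the units, each of which
    misses a non-unit, completes the subsemigroups [family_a U] to a list of
    all maximal subsemigroups as soon as it covers the proper subsemigroups
    containing the units. *)
Lemma maximal_subsemigroupE (L : seq {set pt n}) :
  {in L, forall B : {set pt n},
     [/\ subsemigroup B, B \proper S & D \subset B]} ->
  {in L, forall B : {set pt n}, exists2 x, x \in S :\: D & x \notin B} ->
  {in L &, forall B C : {set pt n}, B \subset C -> B = C} ->
  (forall T, {in T &, forall x y, (x * y)%g \in T} -> D \subset T ->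
     T \proper S -> exists2 B, B \in L & T \subset B) ->
  forall M, maximal_subsemigroup S M =
    (M \in map (@family_a n) (Dmaximals n) ++ L).
Proof.
move=> LB LN La Lc; apply: maxset_antichain.
- move=> B; rewrite mem_cat => /orP[/mapP[U LU ->]|/LB[-> -> _]] //.
  by rewrite family_a_mul // family_a_proper.
- move=> T /andP[Tm TS]; have [DT|nDT] := boolP (D \subset T).
    have [B LB' TB] := Lc T (subsemigroupP _ Tm) DT TS.
    by exists B; rewrite // mem_cat LB' orbT.
  have [U LU TU] := family_a_cover n3 Tm (proper_sub TS) nDT.
  by exists (family_a U); rewrite // mem_cat map_f.
move=> B C; rewrite !mem_cat => /orP[/mapP[U LU ->]|BL] /orP[/mapP[V LV ->]|CL].
- by move/(family_a_anti n3 LU LV)->.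
- move=> /subsetP sub; have [x /setDP[xS xD] /negP[]] := LN C CL.
  by apply: sub; rewrite in_family_a // xS xD.
- have [_ _ DB] := LB B BL => /(subset_trans DB)/subsetP sub.
  have /properP[_ [d dD dV]] := Dmaximals_proper n3 LV.
  by have := sub d dD; rewrite in_family_a // dD andbF (negbTE dV).
- exact: La.
Qed.

Lemma maximal_list_uniq (L : seq {set pt n}) : uniq L ->
  {in L, forall B : {set pt n}, D \subset B} ->
  uniq (map (@family_a n) (Dmaximals n) ++ L).
Proof.
move=> uL LD; rewrite cat_uniq uL andbT map_inj_in_uniq ?Dmaximals_uniq //=.
  apply/hasPn => B BL; apply/negP => BL'.
  have /mapP[V LV BV] : B \in map (@family_a n) (Dmaximals n) := BL'.
  have /properP[_ [d dD dV]] := Dmaximals_proper n3 LV.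
  by have := subsetP (LD B BL) d dD; rewrite BV in_family_a // dD andbF (negbTE dV).
by move=> U V LU LV E; apply: (family_a_anti n3 LU LV); rewrite E.
Qed.

Lemma card_maximal (L : seq {set pt n}) : uniq L ->
  (forall M, maximal_subsemigroup S M = (M \in L)) ->
  #|[set M : {set pt n} | maximal_subsemigroup S M]| = size L.
Proof.
move=> uL ME; rewrite -(card_uniqP uL); apply: eq_card => M.
by rewrite inE ME.
Qed.

Lemma zeta_SD : zeta n \in S :\: D.
Proof.
rewrite zetaE in_setD rotm_PORI ?andbT; last lia.
apply/negP => /(card_unit n3); rewrite (card_interval_group n3); first lia.
by apply/(dihset1P mn); exists 1; left.
Qed.

Lemma zeta_Bset p : 3 < n -> p \in primes m -> zeta n \notin Bset n p.
Proof.
move=> n4 pm; have m3 : 2 < m by lia.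
apply: contra (rotm1_dihset mn m3 n.-2 pm) => zB; rewrite -zetaE.
have pd := primes_dvd pm.
apply: Bset_H => //; rewrite zetaE; by apply/(dihset1P mn); exists 1; left.
Qed.

Lemma units_sub_Bset p : D \subset Bset n p.
Proof. by apply/subsetP => d; apply: unit_Bset. Qed.

Lemma Bset_sub p : Bset n p \subset S.
Proof. by apply/subsetP => x /BsetP[]. Qed.

(** The list of the subsemigroups [family_b n p]. *)
Definition family_bs : seq {set pt n} := map (family_b n) (primes m).

Lemma mem_family_bs B : 3 < n -> B \in family_bs ->
  exists p, [/\ p \in primes m, p %| m & B = Bset n p].
Proof.
move=> n4 /mapP[p pm ->]; exists p.
have pd := primes_dvd pm.
by rewrite (family_bE n3 pd).
Qed.

Lemma Bset_proper p : 3 < n -> p \in primes m -> Bset n p \proper S.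
Proof.
move=> n4 pm; apply/properP; split; first exact: Bset_sub.
by exists (zeta n); [case/setDP: zeta_SD|apply: zeta_Bset].
Qed.

Lemma maximal_ge4 M : 3 < n -> maximal_subsemigroup S M =
  (M \in map (@family_a n) (Dmaximals n) ++ family_bs).
Proof.
move=> n4; apply: maximal_subsemigroupE.
- move=> B /(mem_family_bs n4)[p [pm pd ->]].
  by split; [apply: Bset_subsemigroup|apply: Bset_proper|apply: units_sub_Bset].
- move=> B /(mem_family_bs n4)[p [pm pd ->]]; exists (zeta n); first exact: zeta_SD.
  exact: zeta_Bset.
- move=> B C /(mem_family_bs n4)[p [pm pd ->]] /(mem_family_bs n4)[q [qm qd ->]].
  by move/(Bset_anti n4 pm qm)->.
move=> T Tm DT TS; have [p pm TB] := Bset_cover Tm DT n4 TS.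
exists (Bset n p) => //; apply/mapP; exists p => //; rewrite family_bE //.
exact: primes_dvd.
Qed.

Lemma family_bs_uniq : 3 < n -> uniq family_bs.
Proof.
move=> n4; rewrite map_inj_in_uniq ?primes_uniq // => p q pm qm.
have pd := primes_dvd pm; have qd := primes_dvd qm.
rewrite !family_bE // => E; apply: Bset_anti => //; by rewrite E.
Qed.

Lemma PORI_minus_rank_pred : n = 3 ->
  [/\ subsemigroup (S :\: Jn1 n), S :\: Jn1 n \proper S & D \subset S :\: Jn1 n].
Proof.
move=> nE; have nz : zeta n \notin S :\: Jn1 n.
  rewrite in_setD inE zetaE (card_interval_group n3) ?eqxx //.
  by apply/(dihset1P mn); exists 1; left.
have DS : D \subset S :\: Jn1 n.
  apply/subsetP => d dD; rewrite in_setD (unit_PORI n3 dD) andbT inE.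
  exact/eqP/card_unit_neq.
split=> //; last first.
  apply/properP; split; first exact: subsetDl.
  by exists (zeta n) => //; case/setDP: zeta_SD.
apply/subsemigroupP => x y /setDP[xS xJ] /setDP[yS yJ].
rewrite in_setD PORI_mul // andbT inE; apply/eqP => c.
rewrite !inE in xJ yJ.
have := card_pim_mull x y; have := card_pim_mulr x y; rewrite c => cy cx.
have nx := card_pim_le x; have ny := card_pim_le y.
have xD : x \in D by rewrite -card_pim_full //; lia.
have yD : y \in D by rewrite -card_pim_full //; lia.
by have := card_unit n3 (unit_mul n3 xD yD); rewrite c; lia.
Qed.

Lemma maximal_3 M : n = 3 -> maximal_subsemigroup S M =
  (M \in map (@family_a n) (Dmaximals n) ++ [:: S :\: Jn1 n]).
Proof.
move=> nE; have [h1 h2 h3] := PORI_minus_rank_pred nE.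
apply: maximal_subsemigroupE.
- by move=> B; rewrite inE => /eqP->.
- move=> B; rewrite inE => /eqP->; exists (zeta n); first exact: zeta_SD.
  rewrite in_setD inE zetaE (card_interval_group n3) ?eqxx //.
  by apply/(dihset1P mn); exists 1; left.
- by move=> B C; rewrite !inE => /eqP-> /eqP->.
move=> T Tm DT TS; exists (S :\: Jn1 n); first by rewrite inE.
exact: rank_pred_cover.
Qed.

Lemma card_maximal_PORI :
  #|[set M : {set pt n} | maximal_subsemigroup S M]| =
  1 + size (primes n.-1) + \sum_(p <- primes n) p.
Proof.
have [n4|] := ltnP 3 n.
  rewrite (card_maximal _ (fun M => maximal_ge4 M n4)).
    by rewrite size_cat !size_map size_Dmaximals; lia.
  apply: maximal_list_uniq; first exact: family_bs_uniq.
  by move=> B /(mem_family_bs n4)[p [pm pd ->]]; apply: units_sub_Bset.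
move=> n3'; have nE : n = 3 by lia.
rewrite (card_maximal _ (fun M => maximal_3 M nE)).
  by rewrite size_cat size_map size_Dmaximals nE /=; lia.
apply: maximal_list_uniq => // B; rewrite inE => /eqP->.
by have [] := PORI_minus_rank_pred nE.
Qed.

(** * Green's relations and type (M5) *)

Lemma lideal_sub x y s : s \in S -> x = (s * y)%g ->
  lideal S x \subset lideal S y.
Proof.
move=> sS ->; apply/subsetP => z /imsetP[u uS ->]; apply/imsetP.
by exists (u * s)%g; rewrite ?PORI_mul // mulgA.
Qed.

Lemma rideal_sub x y s : s \in S -> x = (y * s)%g ->
  rideal S x \subset rideal S y.
Proof.
move=> sS ->; apply/subsetP => z /imsetP[u uS ->]; apply/imsetP.
by exists (s * u)%g; rewrite ?PORI_mul // mulgA.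
Qed.

Lemma ideal_sub x y s u : s \in S -> u \in S -> x = (s * y * u)%g ->
  ideal S x \subset ideal S y.
Proof.
move=> sS uS ->; apply/subsetP => z /imset2P[v w vS wS ->]; apply/imset2P.
by exists (v * s)%g (u * w)%g; rewrite ?PORI_mul // !mulgA.
Qed.

Lemma ideal_refl x : x \in ideal S x.
Proof.
apply/imset2P; exists 1%g 1%g; rewrite ?PORI_one //.
by rewrite mul1g mulg1.
Qed.

Lemma greenJ_card x y : greenJ S x y -> #|pim x| = #|pim y|.
Proof.
have le u v : u \in ideal S v -> #|pim u| <= #|pim v|.
  move=> /imset2P[s w _ _ ->]; apply: leq_trans (card_pim_mull _ _) _.
  exact: card_pim_mulr.
move=> /eqP E; apply/eqP; rewrite eqn_leq !le // ?E ?ideal_refl //.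
by rewrite -E ideal_refl.
Qed.

Lemma type_M5_a U : maximal_subgroup (dihedral n) U ->
  maximal_subsemigroup S (family_a U) -> type_M5 S (family_a U).
Proof.
rewrite maximal_subgroupE // => LU maxU; split=> //; exists D; split.
- exists 1%g; first exact: PORI_one.
  apply/setP => x; rewrite in_set; apply/idP/andP => [xD|[xS]].
    have [y yD [xy yx]] := unit_inv n3 xD; have xS := unit_PORI n3 xD.
    have yS := unit_PORI n3 yD; split=> //; rewrite /greenJ eqEsubset.
    rewrite (ideal_sub (s := y) (u := 1%g)) ?PORI_one ?mulg1 ?yx //.
    by rewrite (ideal_sub (s := x) (u := 1%g)) ?PORI_one ?mulg1.
  by move/greenJ_card; rewrite (card_unit n3 (unit_one n3)) -card_pim_full // => <-.
- move=> x xD; have [y yD [xy yx]] := unit_inv n3 xD.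
  by exists y; [apply: unit_PORI|rewrite xy mul1g].
- apply/subsetP => x /setDP[xS]; rewrite in_family_a // xS /= => /norP[+ _].
  by rewrite negbK.
move=> x xD; have [y yD [xy yx]] := unit_inv n3 xD.
have xS := unit_PORI n3 xD; have yS := unit_PORI n3 yD.
exists 1%g.
  rewrite in_setI unit_one // andbT in_family_a //; apply/orP; right.
  by have /and3P[] := Dmaximals_subgroup n3 LU.
rewrite /greenH !eqEsubset.
rewrite (lideal_sub (s := x)) ?mulg1 // (lideal_sub (s := y)) //.
by rewrite (rideal_sub (s := x)) ?mul1g // (rideal_sub (s := y)).
Qed.

(** The elements of rank [n - 1] form one regular J-class: multiplication by
    units on both sides moves any of them into the group [H]. *)
Lemma rank_pred_greenJ x : x \in S -> #|pim x| = n.-1 -> greenJ S e x.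
Proof.
move=> xS cx; have [d1 [d2 [h [d1D d2D hH xE]]]] := rank_pred_factor n3 xS cx.
have [b1 b1D [_ bd1]] := unit_inv n3 d1D.
have [b2 b2D [db2 _]] := unit_inv n3 d2D.
have [g gH [_ gh]] := dihset_inv mn (dvd1n m) hH.
have [eh he] := interval_group_id n3 hH.
have [d1S d2S] := (unit_PORI n3 d1D, unit_PORI n3 d2D).
have [b1S b2S] := (unit_PORI n3 b1D, unit_PORI n3 b2D).
have [hS gS] := (interval_group_PORI n3 hH, interval_group_PORI n3 gH).
rewrite /greenJ eqEsubset (@ideal_sub e x (g * b1)%g b2) ?PORI_mul //.
  rewrite (@ideal_sub x e (d1 * h)%g d2) ?PORI_mul //.
  by rewrite xE -!mulgA (mulgA h) he !mulgA.
by rewrite xE !mulgA -(mulgA _ d2) db2 mulg1 -(mulgA _ b1) bd1 mulg1 gh.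
Qed.

Lemma rank_pred_regular x : x \in S -> #|pim x| = n.-1 ->
  exists2 y, y \in S & (x * y * x)%g = x.
Proof.
move=> xS cx; have [d1 [d2 [h [d1D d2D hH xE]]]] := rank_pred_factor n3 xS cx.
have [b1 b1D [_ bd1]] := unit_inv n3 d1D.
have [b2 b2D [db2 _]] := unit_inv n3 d2D.
have [g gH [hg _]] := dihset_inv mn (dvd1n m) hH.
have [eh _] := interval_group_id n3 hH.
exists (b2 * g * b1)%g.
  have gS := interval_group_PORI n3 gH.
  by apply: PORI_mul; [apply: PORI_mul => //|]; apply: unit_PORI.
rewrite xE !mulgA -(mulgA _ d2) db2 mulg1 -(mulgA _ b1) bd1 mulg1.
by rewrite -(mulgA _ h g) hg -(mulgA _ e) eh.
Qed.

(** Multiplication by an element of [H] inside the product is undone by its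
    inverse, on either side. *)
Lemma rank_pred_greenH d1 d2 h : d1 \in D -> d2 \in D -> h \in H ->
  greenH S (d1 * h * d2)%g (d1 * e * d2)%g.
Proof.
move=> d1D d2D hH; have [b1 b1D [_ bd1]] := unit_inv n3 d1D.
have [b2 b2D [db2 _]] := unit_inv n3 d2D.
have [g gH [hg gh]] := dihset_inv mn (dvd1n m) hH.
have [eh he] := interval_group_id n3 hH.
have [d1S d2S] := (unit_PORI n3 d1D, unit_PORI n3 d2D).
have [b1S b2S] := (unit_PORI n3 b1D, unit_PORI n3 b2D).
have [hS gS] := (interval_group_PORI n3 hH, interval_group_PORI n3 gH).
rewrite /greenH !eqEsubset -!andbA; apply/and4P; split.
- apply: (@lideal_sub _ _ (d1 * h * b1)%g); first by rewrite !PORI_mul.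
  by rewrite !mulgA -(mulgA _ b1) bd1 mulg1 -(mulgA _ h e) he.
- apply: (@lideal_sub _ _ (d1 * g * b1)%g); first by rewrite !PORI_mul.
  by rewrite !mulgA -(mulgA _ b1) bd1 mulg1 -(mulgA _ g h) gh.
- apply: (@rideal_sub _ _ (b2 * h * d2)%g); first by rewrite !PORI_mul.
  by rewrite !mulgA -(mulgA _ d2) db2 mulg1 -(mulgA _ e h) eh.
- apply: (@rideal_sub _ _ (b2 * g * d2)%g); first by rewrite !PORI_mul.
  by rewrite !mulgA -(mulgA _ d2) db2 mulg1 -(mulgA _ h g) hg.
Qed.

Lemma type_M5_b p : p %| m -> maximal_subsemigroup S (Bset n p) ->
  type_M5 S (Bset n p).
Proof.
move=> pd maxB; split=> //.
have eH := interval_group_one n3; have eS := interval_group_PORI n3 eH.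
have mem_J x : x \in S :&: Jn1 n <-> x \in S /\ #|pim x| = n.-1.
  by rewrite in_setI [x \in Jn1 n]inE; split=> [/andP[? /eqP]|[-> /eqP->]].
exists (S :&: Jn1 n); split.
- exists e => //; apply/setP => x; rewrite in_set.
  apply/idP/andP => [/mem_J[xS cx]|[xS /greenJ_card]].
    by split=> //; apply: rank_pred_greenJ.
  by rewrite (card_interval_group n3 eH) => cx; apply/mem_J.
- by move=> x /mem_J[xS cx]; apply: rank_pred_regular.
- apply/subsetP => x /setDP[xS xB]; apply/mem_J; split=> //.
  by apply/eqP; apply: contraNT xB => /eqP cx; apply/BsetP.
move=> x /mem_J[xS cx].
have [d1 [d2 [h [d1D d2D hH ->]]]] := rank_pred_factor n3 xS cx.
exists (d1 * e * d2)%g; last exact: rank_pred_greenH.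
have yS : (d1 * e * d2)%g \in S.
  by apply: PORI_mul; [apply: PORI_mul => //|]; apply: unit_PORI.
rewrite in_setI; apply/andP; split.
  have Bm := subsemigroupP _ (Bset_subsemigroup n3 pd).
  by apply: (Bm); [apply: (Bm); [apply: unit_Bset|]|apply: unit_Bset] => //;
    apply: dihset_Bset => //; apply: dihset_one.
by apply/mem_J; split=> //; rewrite card_pim_mulD // card_interval_group.
Qed.

End Classification.

Theorem theorem3p16 (n : nat) :
  [/\ 4 <= n ->
        [/\ forall M : {set pt n},
              maximal_subsemigroup (PORI n) M <->
              (exists2 U : {set pt n},
                 maximal_subgroup (dihedral n) U & M = family_a U) \/
              (exists2 p : nat, p \in primes n.-1 & M = family_b n p),
            forall U : {set pt n},
              maximal_subgroup (dihedral n) U -> type_M5 (PORI n) (family_a U)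
          & forall p : nat,
              p \in primes n.-1 -> type_M5 (PORI n) (family_b n p)],
      1 <= n <= 3 -> PORI n = symI n
    & 3 <= n ->
        #|[set M : {set pt n} | maximal_subsemigroup (PORI n) M]| =
        1 + size (primes n.-1) + \sum_(p <- primes n) p].
Proof.
split; last exact: card_maximal_PORI.
  move=> n4; have n3 : 3 <= n by apply: ltnW.
  have max_a U : maximal_subgroup (dihedral n) U ->
      maximal_subsemigroup (PORI n) (family_a U).
    by rewrite maximal_subgroupE // maximal_ge4 // mem_cat => LU; rewrite map_f.
  have max_b p : p \in primes n.-1 ->
      maximal_subsemigroup (PORI n) (family_b n p).
    by move=> pm; rewrite maximal_ge4 // mem_cat map_f // orbT.
  split=> [M|U maxU|p pm].
  - split=> [|[[U maxU ->]|[p pm ->]]]; [|exact: max_a|exact: max_b].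
    rewrite maximal_ge4 // mem_cat => /orP[/mapP[U LU ->]|/mapP[p pm ->]].
      by left; exists U => //; rewrite maximal_subgroupE.
    by right; exists p.
  - exact: type_M5_a (max_a U maxU).
  have pd := primes_dvd pm.
  by have := max_b p pm; rewrite family_bE //; apply: type_M5_b.
by case/andP=> _; apply: PORI_small.
Qed.
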